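(* Let $M>0$, $0<\varepsilon'<1/3$ and $\beta=\{\Phi^{-1}(3/4)\}^2$. There exist constants $c>0$ and $C^{*}>0$ (depending on $\varepsilon'$ and the fixed $M$, but independent of $p,n,\varepsilon$) such that, for every $\varepsilon\in[0,\varepsilon']$, every $\delta\in(0,1/2)$ and all $p,n$ with $(p+\log(1/\delta))/n\le c$, $$\inf_{\Sigma\in\mathcal{F}(M),\ P\in\mathcal{P}_\varepsilon(N_p(\mathbf 0,\Sigma))}P\left(\|\hat\Sigma-\Sigma\|_{op}^2\le C^{*}\left(\max\left\{\frac pn,\,B_E^2(\varepsilon)\right\}+\frac{\log(1/\delta)}{n}\right)\right)\ge 1-2\delta ,$$ where $\hat\Sigma=\beta^{-1}\hat\Gamma_n$, $\hat\Gamma_n$ is the deepest scatter matrix (known location $\mathbf 0$) of an i.i.d. sample of size $n$ from $P$, and $$B_E(\varepsilon)=\frac{1}{\sqrt\beta}\,\Phi^{-1}\!\left(\frac{3-\varepsilon}{4(1-\varepsilon)}\right)-1 .$$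
   Context: $\Phi$ is the standard normal distribution function; $\|\cdot\|_{op}$ is the operator norm. $\mathcal{F}(M)$ is the set of symmetric positive definite $p\times p$ matrices whose largest eigenvalue is less than $M$. $\mathcal{P}_\varepsilon(P_0^E)=\{(1-\varepsilon)P_0^E+\varepsilon G: G\text{ any distribution on }\mathbb{R}^p\}$. The scatter depth (known location $\mathbf 0$) of $\Gamma\succeq 0$ with respect to $P$, $\mathbf X\sim P$, is $$D_S(\Gamma,P)=\inf_{\mathbf u\in\mathbb{R}^p,\|\mathbf u\|=1}\min\{P(|\mathbf u^t\mathbf X|^2\le \mathbf u^t\Gamma\mathbf u),\,P(|\mathbf u^t\mathbf X|^2\ge \mathbf u^t\Gamma\mathbf u)\},$$ and $\hat\Gamma_n\in\arg\max_{\Gamma\succeq 0}D_S(\Gamma,P_n)$ with $P_n$ the empirical distribution of the sample. *)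

(* Defs.v *)
From HB Require Import structures.
From mathcomp Require Import all_boot all_order all_algebra.
From mathcomp Require Import all_classical all_reals all_analysis.

Set Implicit Arguments.
Unset Strict Implicit.
Unset Printing Implicit Defensive.

Import Order.TTheory GRing.Theory Num.Theory.
Import numFieldNormedType.Exports.

Local Open Scope classical_set_scope.
Local Open Scope ring_scope.

Section matrices.
Context {R : realType} {p : nat}.
Implicit Types (u : 'cV[R]_p) (A : 'M[R]_p).

Definition enorm u : R := Num.sqrt (\sum_(i < p) u i 0 ^+ 2).

Definition unit_sphere : set 'cV[R]_p := [set u | enorm u = 1].

Definition opnorm A : R := sup [set enorm (A *m u) | u in unit_sphere].

Definition qform A u : R := (u^T *m A *m u) 0 0.

Definition psd A : Prop := A^T = A /\ forall u, 0 <= qform A u.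

Definition posdef A : Prop := A^T = A /\ forall u, u != 0 -> 0 < qform A u.

(* "largest eigenvalue less than M" *)
Definition spd_below (M : R) : set 'M[R]_p :=
  [set A | posdef A /\ forall a, eigenvalue A a -> a < M].

End matrices.

(* R^p as a measurable space is p.-tuple R: its sigma-algebra, generated by the
   coordinate projections, is the Borel one. *)
Definition colv {R : realType} {p : nat} (x : p.-tuple R) : 'cV[R]_p :=
  \col_i tnth x i.

Definition mulmxt {R : realType} {p : nat} (A : 'M[R]_p) (x : p.-tuple R) :
  p.-tuple R := [tuple (A *m colv x) i 0 | i < p].

Definition dotp {R : realType} {p : nat} (u : 'cV[R]_p) (x : p.-tuple R) : R :=
  (u^T *m colv x) 0 0.

Section normal.
Context {R : realType}.

Definition Phi (x : R) : R := fine (normal_prob (0 : R) 1 `]-oo, x]).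

(* Only meaningful for 0 < q < 1, where the preimage is a singleton. *)
Definition Phi_inv (q : R) : R := xget 0 [set x | Phi x = q].

Definition beta : R := Phi_inv (3 / 4) ^+ 2.

Definition B_E (eps : R) : R :=
  (Num.sqrt beta)^-1 * Phi_inv ((3 - eps) / (4 * (1 - eps))) - 1.

(* Law of Z = (Z_1, ..., Z_p) with independent N(0, 1) coordinates; a
   probability on R^p is determined by its values on measurable boxes. *)
Definition std_normal_vec {p : nat} (Q : probability (p.-tuple R) R) : Prop :=
  forall A : 'I_p -> set R, (forall i, measurable (A i)) ->
    Q [set z | forall i, A i (tnth z i)]
    = (\prod_(i < p) normal_prob (0 : R) 1 (A i))%E.

(* N_p(0, Sigma) is the law of L Z with Z standard normal, L L^T = Sigma. *)
Definition normal_vec {p : nat} (Sigma : 'M[R]_p)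
    (P : probability (p.-tuple R) R) : Prop :=
  exists (L : 'M[R]_p) (Q : probability (p.-tuple R) R),
    [/\ L *m L^T = Sigma, std_normal_vec Q &
      forall B, measurable B -> P B = Q (mulmxt L @^-1` B)].

(* The contamination neighbourhood of P0. *)
Definition contaminated {p : nat} (eps : R) (P0 : probability (p.-tuple R) R) :
    set (probability (p.-tuple R) R) :=
  [set P | exists G : probability (p.-tuple R) R, forall B, measurable B ->
     P B = ((1 - eps)%:E * P0 B + eps%:E * G B)%E].

End normal.

Section depth.
Context {R : realType} {p : nat}.

Definition scatter_depth (Gamma : 'M[R]_p) (P : set (p.-tuple R) -> \bar R) :
    \bar R :=
  ereal_inf [set mine (P [set x | `|dotp u x| ^+ 2 <= qform Gamma u])
                      (P [set x | `|dotp u x| ^+ 2 >= qform Gamma u])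
            | u in unit_sphere].

Definition empirical {n : nat} (x : 'I_n -> p.-tuple R) (A : set (p.-tuple R)) :
    \bar R := ((n%:R^-1)%:E * \sum_(i < n) \d_(x i) A)%E.

Definition deepest_scatter (P : set (p.-tuple R) -> \bar R) : set 'M[R]_p :=
  [set Gamma | psd Gamma /\
     forall Gamma', psd Gamma' -> (scatter_depth Gamma' P <= scatter_depth Gamma P)%E].

End depth.

Section sampling.
Context {R : realType} {d : measure_display} {Omega : measurableType d}.
Context (Pr : probability Omega R).

Definition mutually_independent {d' : measure_display} {T : measurableType d'}
    {n : nat} (X : 'I_n -> {RV Pr >-> T}) : Prop :=
  forall (J : {set 'I_n}) (A : 'I_n -> set T), (forall i, measurable (A i)) ->
    Pr [set w | forall i, i \in J -> A i (X i w)]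
    = (\prod_(i in J) Pr (X i @^-1` A i))%E.

Definition iid_sample {d' : measure_display} {T : measurableType d'}
    {n : nat} (P : probability T R) (X : 'I_n -> {RV Pr >-> T}) : Prop :=
  mutually_independent X /\
  forall i A, measurable A -> distribution Pr (X i) A = P A.

(* Inner probability: argmax selections need not be measurable. *)
Definition inner_prob (E : set Omega) : \bar R :=
  ereal_sup [set Pr A | A in [set A | measurable A /\ A `<=` E]].

Lemma inner_prob_measurable (E : set Omega) :
  measurable E -> inner_prob E = Pr E.
Proof.
move=> mE; apply/eqP; rewrite eq_le; apply/andP; split.
- apply: ge_ereal_sup => _ [A [mA AE] <-].
  by apply: le_measure => //; exact/mem_set.
- by apply: ereal_sup_ubound; exists E => //; split.
Qed.

End sampling.

(* Main.v *)
Require Import Defs.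
From HB Require Import structures.
From mathcomp Require Import all_boot all_order all_algebra.
From mathcomp Require Import all_classical all_reals all_analysis.
From mathcomp Require Import measurable_realfun.
From mathcomp Require Import ring lra.

Set Implicit Arguments.
Unset Strict Implicit.
Unset Printing Implicit Defensive.

Import Order.TTheory GRing.Theory Num.Theory.
Import numFieldNormedType.Exports.

Local Open Scope classical_set_scope.
Local Open Scope ring_scope.

(** Let [b = Phi^-1 (3 / 4)], so that [beta = b ^ 2] and the standard normal law
   gives mass 1/2 to [|z| <= b].  For a unit vector [u] put
   [z = u^T X / sqrt (u^T Sigma u)], which is standard normal when the law of
   [X] is N(0, Sigma).

   Suppose that, for all directions [u] at once, the empirical frequency of each
   of the events [|z| <= b], [|z| >= b], [|z| < b + y] and [|z| > b - y] is at
   least [1 - eps] times its normal probability, up to an error [r].  The first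
   two say that [beta Sigma] has empirical depth at least [(1 - eps) / 2 - r],
   hence so has the deepest matrix.  If the latter had
   [u^T Gamma u > (b + y)^2 u^T Sigma u], then its event
   [|u^T X|^2 >= u^T Gamma u] would be disjoint from [|z| < b + y], and the two
   frequencies would add up to more than 1 once [y] is [b B_E(eps)] plus a
   multiple of [r] ([B_E_calibration]); likewise from below.  Therefore
   [Gamma / beta - Sigma] has a quadratic form of order [y] on the sphere
   ([deepest_scatter_close]; the form of [Sigma] is at most [M] by
   [qform_le_eigenvalue_bound]), which bounds its operator norm by
   [opnorm_sym_le].

   The point is that [r] can be taken of order [sqrt rho],
   [rho = (p + log (1 / delta)) / n], without a logarithmic factor.  Only lower
   bounds on frequencies are needed, so sample points may be weighted by the
   density [f <= 1] of [(1 - eps) P0] with respect to [P] ([bounded_density]):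
   weighted means are then normal probabilities, whatever the contamination.
   Chaining is done over the direction [v], the law N(0, Sigma) being reduced to
   a standard one ([normal_vec_dotp]).  The [k]-th net approximates the sphere to
   within [8 ^ - k] and has [exp (O (k p))] points ([sphere_net]).  Moving between
   neighbouring points of consecutive nets changes the event on a set of normal
   mass [O (4 ^ - k)], so by [bernstein] all increments at level [k] deviate by
   [O (k 2 ^ - k sqrt rho)], which is summable.  The chaining stops at the last
   level [K] where Bernstein's inequality is subgaussian, [4 ^ - K] of order
   [rho].  Passing from the last net point [w] to [v] only matters for sample
   points with a large component along [v - w]; their number is controlled by
   the operator norm of the weighted empirical covariance, which is bounded
   ([covariance_point], [qform_net_le]).  A bound on the norms of the sample
   points would do the same at the cost of a factor [log p].  The result is
   [chaining_lower_bound]. *)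


(** * Events of high probability *)

Section whp.
Context {R : realType} {d : measure_display} {Omega : measurableType d}.
Variable Pr : probability Omega R.

(** The events below are intersections over all directions of the sphere and
   need not be measurable, hence the measurable core.  The calculus consists of
   monotonicity and of the union bound. *)
Definition whp (eta : R) (E : set Omega) : Prop :=
  exists A, [/\ measurable A, A `<=` E & ((1 - eta)%:E <= Pr A)%E].

Lemma whp_inner_prob eta E : whp eta E -> ((1 - eta)%:E <= inner_prob Pr E)%E.
Proof.
move=> [A [mA AE le_A]]; apply: (le_trans le_A).
by apply: ereal_sup_ubound; exists A.
Qed.

Lemma whp_sub eta eta' (E E' : set Omega) :
  eta <= eta' -> E `<=` E' -> whp eta E -> whp eta' E'.
Proof.
move=> le_eta sEE' [A [mA AE le_A]]; exists A; split=> //.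
  exact: subset_trans sEE'.
by apply: le_trans le_A; rewrite lee_fin lerB.
Qed.

Lemma whpT eta : 0 <= eta -> whp eta setT.
Proof.
move=> eta0; exists setT; split=> //.
by rewrite probability_setT lee_fin gerBl.
Qed.

Lemma whpI eta1 eta2 E1 E2 :
  whp eta1 E1 -> whp eta2 E2 -> whp (eta1 + eta2) (E1 `&` E2).
Proof.
move=> [A [mA AE le_A]] [B [mB BE le_B]]; exists (A `&` B); split.
- exact: measurableI.
- exact: setISS.
- have mAB := measurableI _ _ mA mB.
  have /= := @measureU2 _ _ _ Pr _ _ (measurableC mA) (measurableC mB).
  rewrite -setCI !probability_setC//.
  move: le_A le_B.
  rewrite -(fineK (fin_num_measure Pr _ mA)) -(fineK (fin_num_measure Pr _ mB)).
  rewrite -(fineK (fin_num_measure Pr _ mAB)) -!EFinB -EFinD !lee_fin.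
  lra.
Qed.

Lemma whp_seq (I : eqType) (s : seq I) (eta : I -> R) (E : I -> set Omega) :
  (forall i, i \in s -> whp (eta i) (E i)) ->
  whp (\sum_(i <- s) eta i) [set w | forall i, i \in s -> E i w].
Proof.
elim: s => [_|i s IHs Es].
  by rewrite big_nil; apply: whp_sub (whpT (lexx 0)) => // w _ i; rewrite in_nil.
rewrite big_cons.
have Es' j : j \in s -> whp (eta j) (E j) by move=> js; apply: Es; rewrite inE js orbT.
apply: whp_sub (whpI (Es _ (mem_head _ _)) (IHs Es')) => // w [Ew Esw] j.
by rewrite inE => /predU1P[->//|]; exact: Esw.
Qed.

End whp.

(** * Laws of tuples of independent variables *)

Section tuple_law.
Context {R : realType} {d : measure_display} {T : measurableType d}.
Implicit Types (nu : probability T R).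

(** This is the product measure [nu ^ n], characterised by its values on boxes;
   it covers both a standard normal vector ([nu] normal on the line) and an
   i.i.d. sample ([nu] a law on [R ^ p]). *)
Definition power_law n nu (mu : set (n.-tuple T) -> \bar R) : Prop :=
  forall A : 'I_n -> set T, (forall i, measurable (A i)) ->
    mu [set z | forall i, A i (tnth z i)] = (\prod_(i < n) nu (A i))%E.

Definition box n (A : 'I_n -> set T) : set (n.-tuple T) :=
  [set z | forall i, A i (tnth z i)].

Lemma measurable_box n (A : 'I_n -> set T) :
  (forall i, measurable (A i)) -> measurable (box A).
Proof.
move=> mA.
have -> : box A = \bigcap_(i in [set: 'I_n]) ((@tnth _ T ^~ i) @^-1` A i).
  by apply/seteqP; split=> z zA; [move=> i _; exact: zA|move=> i; exact: (zA i I)].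
apply: fin_bigcap_measurable => // i _.
by rewrite -[X in measurable X]setTI; apply: measurable_tnth.
Qed.

Lemma measurable_tuple_box n :
  @measurable _ (n.-tuple T) =
  <<s [set box A | A in [set A : 'I_n -> set T | forall i, measurable (A i)]] >>.
Proof.
apply/seteqP; split; last first.
  apply: smallest_sub; first exact: sigma_algebra_measurable.
  by move=> _ [A mA <-]; exact: measurable_box.
apply: smallest_sub; first exact: smallest_sigma_algebra.
case: n => [|n].
  by rewrite big_ord0.
rewrite -bigcup_mkord_ord; apply: bigcup_sub => k kn _ [B mB <-].
apply: sub_sigma_algebra.
exists (fun i => if i == inord k then B else setT).
  by move=> i; case: ifP.
apply/seteqP; split=> z /=.
  by move=> /(_ (inord k)); rewrite eqxx.
by case=> _ Bz i; case: eqVneq => // ->.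
Qed.

Lemma power_law_unique n (mu1 mu2 : {measure set (n.-tuple T) -> \bar R}) nu :
  power_law nu mu1 -> power_law nu mu2 ->
  forall A, measurable A -> mu1 A = mu2 A.
Proof.
move=> mu1E mu2E A mA.
pose S : 'I_n -> set T := fun=> setT.
have boxT : box S = setT by apply/seteqP; split.
apply: (measure_unique _ (fun=> setT) (@measurable_tuple_box n)) => //.
- move=> _ _ [B mB <-] [C mC <-]; exists (fun i => B i `&` C i).
    by move=> i; apply: measurableI.
  apply/seteqP; split=> z /=; first by move=> zBC; split=> i; case: (zBC i).
  by case=> zB zC i; split.
- by move=> _; exists S => // i; exact: measurableT.
- by rewrite bigcup_const.
- by move=> _ [B mB <-]; rewrite mu1E ?mu2E.
- move=> _; rewrite -boxT mu1E /S; last by move=> ?; exact: measurableT.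
  rewrite big1 ?ltry// => i _; exact: probability_setT.
Qed.

(** The box of [behead] is the box whose first side is the whole space, and the
   latter has mass one. *)
Lemma power_law_behead n nu (mu : probability (n.+1.-tuple T) R) :
  power_law nu mu -> exists mu' : probability (n.-tuple T) R, power_law nu mu'.
Proof.
move=> muE.
pose f := fun x : n.+1.-tuple T => [tuple of behead x].
have mf : measurable_fun setT f := @measurable_behead _ T n.
pose F : {mfun n.+1.-tuple T >-> n.-tuple T} := HB.pack f (isMeasurableFun.Build _ _ _ _ f mf).
exists (distribution mu F) => A mA /=.
pose B i := if unlift ord0 i is Some j then A j else setT.
have -> : distribution mu F [set z | forall i, A i (tnth z i)] = mu (box B).
  congr (mu _); apply/seteqP; split=> z /= zA i.
    rewrite /B; case: unliftP => // j ->.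
    by have := zA j; rewrite tnth_behead// (_ : inord j.+1 = lift ord0 j) //; apply: val_inj; rewrite /= inordK// ltnS.
  have := zA (lift ord0 i); rewrite /B liftK tnth_behead.
  by rewrite (_ : inord i.+1 = lift ord0 i) //; apply: val_inj; rewrite /= inordK// ltnS.
rewrite muE; last by move=> i; rewrite /B; case: unliftP.
rewrite big_ord_recl /B unlift_none probability_setT mul1e.
by apply: eq_bigr => i _; rewrite liftK.
Qed.

(** Both sides integrate against probabilities that agree on boxes; Tonelli's
   theorem splits off the first coordinate.  All inductions on the number of
   coordinates go through this lemma. *)
Lemma integral_power_law_cons n nu (mu : probability (n.+1.-tuple T) R)
    (mu' : probability (n.-tuple T) R) (h : n.+1.-tuple T -> \bar R) :
  power_law nu mu -> power_law nu mu' ->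
  measurable_fun setT h -> (forall z, 0 <= h z)%E ->
  (\int[mu]_z h z = \int[nu]_x \int[mu']_z h [tuple of x :: z])%E.
Proof.
move=> muE mu'E mh h0.
pose f := fun xz : T * n.-tuple T => [the n.+1.-tuple T of xz.1 :: xz.2].
have mf : measurable_fun setT f by apply: measurable_cons.
pose F : {mfun (T * n.-tuple T)%type >-> n.+1.-tuple T} :=
  HB.pack f (isMeasurableFun.Build _ _ _ _ f mf).
pose P : probability _ R := distribution (nu \x mu')%E F.
have PE : power_law nu P.
  move=> A mA.
  have -> : P [set z | forall i, A i (tnth z i)] =
            (nu \x mu')%E (A ord0 `*` box (fun i => A (lift ord0 i))).
    congr ((nu \x mu')%E _); apply/seteqP; split=> -[x z] /=.
      move=> zA; split=> [|i]; first exact: (zA ord0).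
      by have := zA (lift ord0 i); rewrite tnthS.
    move=> [xA zA] i; have [j ->|->//] := unliftP ord0 i.
    by rewrite tnthS; exact: zA.
  rewrite product_measure1E//; last exact: measurable_box.
  by rewrite big_ord_recl; congr (_ * _)%E; exact: (mu'E (fun i => A (lift ord0 i))).
have -> : (\int[mu]_z h z = \int[P]_z h z)%E.
  by apply: eq_measure_integral => A mA _; exact: (power_law_unique muE PE).
rewrite ge0_integral_distribution//.
rewrite (fubini_tonelli1 (h \o F))//.
  exact: measurableT_comp.
by move=> ?; exact: h0.
Qed.

End tuple_law.

Lemma integral_expR_sum_power_law {R : realType} {d : measure_display}
    {T : measurableType d} n (nu : probability T R)
    (mu : probability (n.-tuple T) R) (h : T -> R) :
  power_law nu mu -> measurable_fun setT h ->
  (\int[mu]_z (expR (\sum_(i < n) h (tnth z i)))%:E =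
   \prod_(i < n) \int[nu]_x (expR (h x))%:E)%E.
Proof.
move=> + mh; elim: n mu => [|n IHn] mu muE.
  under eq_integral do rewrite big_ord0 expR0.
  by rewrite big_ord0 integral_cst// mul1e; exact: (probability_setT mu).
have [mu' mu'E] := power_law_behead muE.
have mS m : measurable_fun [set: m.-tuple T]
    (fun z => (expR (\sum_(i < m) h (tnth z i)))%:E).
  apply/measurable_EFinP; apply: measurableT_comp => //; apply: measurable_sum => i.
  by apply: measurableT_comp => //; exact: measurable_tnth.
have mg : measurable_fun setT (fun x => (expR (h x))%:E).
  by apply/measurable_EFinP; apply: measurableT_comp.
rewrite (integral_power_law_cons muE mu'E)//.
transitivity (\int[nu]_x ((\prod_(i < n) \int[nu]_x (expR (h x))%:E) *
                          (expR (h x))%:E))%E.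
  apply: eq_integral => x _.
  rewrite (eq_integral (fun z : n.-tuple T =>
      (expR (h x))%:E * (expR (\sum_(i < n) h (tnth z i)))%:E)%E); last first.
    move=> z _; rewrite big_ord_recl expRD EFinM; congr (_ * _)%E.
    by congr (expR _)%:E; apply: eq_bigr => i _; rewrite tnthS.
  rewrite ge0_integralZl_EFin ?expR_ge0//; last exact: mS.
  by rewrite IHn// muleC.
rewrite ge0_integralZl//; first by rewrite big_ord_recl muleC.
by apply: prode_ge0 => i _; apply: integral_ge0.
Qed.

(** * Exponential concentration for an i.i.d. sample *)

Section chernoff.
Context {R : realType} {d d' : measure_display} {Omega : measurableType d}.
Context {T : measurableType d'} {Pr : probability Omega R}.
Context {n : nat} {P : probability T R} {X : 'I_n -> {RV Pr >-> T}}.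
Hypothesis iidX : iid_sample P X.

Lemma integral_expR_sum_iid (h : T -> R) : measurable_fun setT h ->
  (\int[Pr]_w (expR (\sum_(i < n) h (X i w)))%:E =
   \prod_(i < n) \int[P]_x (expR (h x))%:E)%E.
Proof.
move=> mh; pose f w := [tuple X i w | i < n].
have mf : measurable_fun setT f.
  apply/measurable_fun_tnthP => i.
  rewrite (_ : _ \o _ = X i)//; apply/funext => w /=.
  by rewrite tnth_mktuple.
pose F : {RV Pr >-> n.-tuple T} := HB.pack f (isMeasurableFun.Build _ _ _ _ f mf).
have lawF : power_law P (distribution Pr F).
  move=> A mA; have [indX lawX] := iidX.
  have := indX [set: 'I_n]%SET A mA.
  under [in RHS]eq_bigl do rewrite inE.
  move=> indXA; rewrite (eq_bigr (fun i => Pr (X i @^-1` A i))).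
    rewrite -indXA; congr (Pr _); apply/seteqP; split=> w /= XA i.
      by move=> _; have := XA i; rewrite tnth_mktuple.
    by rewrite tnth_mktuple; apply: XA; rewrite inE.
  by move=> i _; rewrite -(lawX i).
rewrite -(integral_expR_sum_power_law lawF)// ge0_integral_distribution//.
  by apply: eq_integral => w _ /=; congr (expR _)%:E; apply: eq_bigr => i _; rewrite tnth_mktuple.
apply/measurable_EFinP; apply: measurableT_comp => //; apply: measurable_sum => i.
by apply: measurableT_comp => //; exact: measurable_tnth.
Qed.

(** Markov's inequality for [exp (\sum_i h (X i))].  The threshold and the
   tuning parameter are absorbed into [h]. *)
Lemma chernoff (h : T -> R) (b : R) : measurable_fun setT h ->
  (\int[P]_x (expR (h x))%:E <= (expR (- b))%:E)%E ->
  whp Pr (expR (- (n%:R * b))) [set w | \sum_(i < n) h (X i w) <= 0].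
Proof.
move=> mh hb.
have mS : measurable_fun [set: Omega] (fun w => \sum_(i < n) h (X i w)).
  by apply: measurable_sum => i; apply: measurableT_comp.
have mA : measurable [set w | \sum_(i < n) h (X i w) <= 0].
  rewrite -[X in measurable X]setTI.
  have := mS measurableT _ (measurable_itv `]-oo, 0]).
  by congr (measurable (_ `&` _)); apply/seteqP; split=> w /=; rewrite in_itv.
exists [set w | \sum_(i < n) h (X i w) <= 0]; split => //.
rewrite -[X in Pr X]setCK probability_setC; last exact: measurableC.
rewrite EFinB; apply: leeB => //.
set B := ~` _; have mB : measurable B by exact: measurableC.
have -> : Pr B = (\int[Pr]_w (\1_B w)%:E)%E by rewrite integral_indic// setIT.
apply: (@le_trans _ _ (\int[Pr]_w (expR (\sum_(i < n) h (X i w)))%:E)%E).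
  apply: ge0_le_integral => //=.
  - by apply/measurable_EFinP.
  - by apply/measurable_EFinP; apply: measurableT_comp.
  - move=> w _; rewrite lee_fin indicE; have [|_] := boolP (w \in B); last exact: expR_ge0.
    rewrite inE /B /= => /negP; rewrite -ltNge => h0.
    by rewrite -expR0 ler_expR ltW.
rewrite integral_expR_sum_iid// (_ : expR (- (n%:R * b)) = \prod_(i < n) expR (- b)).
  rewrite -prodEFin.
  suff /andP[] : (0 <= \prod_(i < n) \int[P]_x (expR (h x))%:E <=
                  \prod_(i < n) (expR (- b))%:E)%E by [].
  elim/big_ind2 : _ => [|x1 x2 y1 y2 /andP[x10 x12] /andP[y10 y12]|i _].
  - by rewrite lee_fin ler01 lexx.
  - by rewrite mule_ge0//= lee_pmul.
  - by rewrite hb integral_ge0// => x _; rewrite lee_fin expR_ge0.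
by rewrite -expR_sum sumr_const card_ord mulNrn mulr_natl.
Qed.

End chernoff.

(** * The density of the uncontaminated part *)

Section density.
Context {R : realType} {d : measure_display} {T : measurableType d}.
Context (P0 P : probability T R) (c : R).
Hypothesis c_ge0 : 0 <= c.
Hypothesis le_P : forall B, measurable B -> (c%:E * P0 B <= P B)%E.

Let nu := mscale (NngNum c_ge0) P0.

(** The weight [f] is the Radon-Nikodym derivative of [c P0] with respect to
   [P], set to 0 where it exceeds 1; domination by [P] makes that set null.
   Weighting the sample points by [f] turns statements on the arbitrary law [P]
   into statements on [P0], and [f <= 1] keeps them lower bounds for the
   unweighted counts. *)
Lemma bounded_density : exists f : T -> R,
  [/\ measurable_fun setT f, (forall x, 0 <= f x <= 1) &
      forall h : T -> \bar R, measurable_fun setT h -> (forall x, 0 <= h x)%E ->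
        (\int[P]_x ((f x)%:E * h x) = c%:E * \int[P0]_x h x)%E].
Proof.
have nuE B : nu B = (c%:E * P0 B)%E by [].
have nuP : nu `<< P.
  apply/null_content_dominatesP => A mA PA0; apply/eqP; rewrite eq_le measure_ge0 andbT.
  by rewrite -PA0 nuE le_P.
pose f0 := Radon_Nikodym_SigmaFinite.f nu P.
have f0_ge0 : forall x, (0 <= f0 x)%E := Radon_Nikodym_SigmaFinite.f_ge0 nuP.
have f0_fin : forall x, f0 x \is a fin_num := Radon_Nikodym_SigmaFinite.f_fin_num nuP.
have mf0 : measurable_fun setT f0.
  by have /integrableP[] := Radon_Nikodym_SigmaFinite.f_integrable nuP.
pose D := [set x | (1 < f0 x)%E].
have mD : measurable D.
  rewrite -[D]setTI; exact: emeasurable_fun_o_infty.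
have mf01 : measurable_fun D (fun x => f0 x - 1)%E.
  by apply: emeasurable_funB => //; exact: measurable_funTS.
have f01_ge0 x : D x -> (0 <= f0 x - 1)%E.
  by move=> /ltW; rewrite sube_ge0//.
have PD0 : P D = 0%E.
  have : (\int[P]_(x in D) (f0 x - 1) = 0)%E.
    apply/eqP; rewrite eq_le integral_ge0 ?andbT//.
    have : (P D + \int[P]_(x in D) (f0 x - 1) <= P D)%E.
      apply: (@le_trans _ _ (nu D)); last by rewrite nuE le_P.
      have -> : nu D = (\int[P]_(x in D) f0 x)%E :=
        Radon_Nikodym_SigmaFinite.f_integral nuP mD.
      rewrite -[P D]mul1e -(integral_cst P mD 1%E) -ge0_integralD//.
      apply: ge0_le_integral => //.
      - by move=> x Dx; rewrite adde_ge0// f01_ge0.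
      - by apply: emeasurable_funD => //; exact: measurable_cst.
      - exact: measurable_funTS.
      - by move=> x Dx; rewrite addeC subeK.
    rewrite -(fineK (fin_num_measure P _ mD)).
    by rewrite -{2}[(fine (P D))%:E]adde0 leeD2lE.
  move=> int0.
  have : (\int[P]_(x in D) `|f0 x - 1| = 0)%E.
    rewrite -[RHS]int0; apply: eq_integral => x /[!inE] Dx.
    by rewrite gee0_abs// f01_ge0.
  move=> /(ae_eq_integral_abs P mD mf01) [N [mN N0 DN]].
  apply/eqP; rewrite eq_le measure_ge0 andbT -N0; apply: le_measure; rewrite ?inE//.
  move=> x Dx; apply: DN => /= /(_ Dx); move: Dx (f0_fin x); rewrite /D /=.
  case: (f0 x) => //= r; rewrite lte_fin => r1 _ [] /eqP.
  by rewrite subr_eq0 gt_eqF.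
pose f x := if x \in D then 0 else fine (f0 x).
exists f; split.
- apply: measurable_fun_ifT => //.
    by apply: (measurable_fun_bool true); rewrite setTI (_ : _ @^-1` _ = D)//; apply/seteqP; split=> x /=; [move=> /set_mem|move=> ?; apply/mem_set].
  exact: measurableT_comp.
- move=> x; rewrite /f; case: ifPn; first by rewrite lexx ler01.
  rewrite notin_setE /D /= => /negP; rewrite -leNgt => f1.
  by rewrite fine_ge0//= -lee_fin fineK.
- move=> h mh h0.
  transitivity (\int[P]_x (h x * f0 x))%E.
    apply: ge0_ae_eq_integral => //.
    - apply: emeasurable_funM => //; apply/measurable_EFinP.
      apply: measurable_fun_ifT => //.
        by apply: (measurable_fun_bool true); rewrite setTI (_ : _ @^-1` _ = D)//; apply/seteqP; split=> x /=; [move=> /set_mem|move=> ?; apply/mem_set].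
      exact: measurableT_comp.
    - exact: emeasurable_funM.
    - move=> x _; rewrite mule_ge0// lee_fin /f; case: ifP => // _.
      by rewrite fine_ge0.
    - by move=> x _; rewrite mule_ge0.
    - exists D; split=> // x /=; apply: contra_notP => nDx _.
      by rewrite /f memNset// fineK// muleC.
  rewrite Radon_Nikodym_SigmaFinite.change_of_variables// ge0_integral_mscale//.
Qed.

End density.

(** * Linear images of normal laws *)

Section lebesgue_affine.
Context {R : realType}.
Notation mu := (@lebesgue_measure R).
Variables (a b : R).
Let aff (x : measurableTypeR R) : measurableTypeR R := (a * (x : R) + b)%R.

Let measurable_aff : measurable_fun [set: measurableTypeR R] aff.
Proof. by apply: measurable_funD => //; exact: measurable_funM. Qed.

Let law : {measure set (measurableTypeR R) -> \bar R} :=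
  measure_function_pushforward__canonical__measure_function_Measure mu measurable_aff.

Hypothesis a0 : a != 0.

Let aff_ocitv u v : (lebesgue_measure (aff @^-1` `]u, v]) = (`|a|^-1)%:E * mu `]u, v])%E.
Proof.
have [a_lt0|a_gt0|aE] := ltgtP a 0; last by move: a0; rewrite aE eqxx.
- have -> : aff @^-1` `]u, v] = `[(v - b) / a, (u - b) / a[%classic.
    apply/seteqP; split=> x; rewrite /aff /= !in_itv/= ler_ndivrMr// ltr_ndivlMr// => /andP[h1 h2];
    apply/andP; split; lra.
  rewrite !lebesgue_measure_itv/= !lte_fin ltr_ndivrMr// divfK ?lt_eqF//.
  have -> : (u - b < v - b) = (u < v) by rewrite ltrD2r.
  case: ifP => _; last by rewrite mule0.
  by rewrite -EFinM; congr (_%:E); rewrite ltr0_norm//; field; rewrite lt_eqF.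
- have -> : aff @^-1` `]u, v] = `](u - b) / a, (v - b) / a]%classic.
    apply/seteqP; split=> x; rewrite /aff /= !in_itv/= ler_pdivlMr// ltr_pdivrMr// => /andP[h1 h2];
    apply/andP; split; lra.
  rewrite !lebesgue_measure_itv/= !lte_fin ltr_pdivrMr// divfK ?gt_eqF//.
  have -> : (u - b < v - b) = (u < v) by rewrite ltrD2r.
  case: ifP => _; last by rewrite mule0.
  by rewrite -EFinM; congr (_%:E); rewrite gtr0_norm//; field; rewrite gt_eqF.
Qed.

Let normV_ge0 : 0 <= `|a|. Proof. by []. Qed.

Let pushforward_aff A : measurable A ->
  mu A = mscale (NngNum normV_ge0) law A.
Proof.
apply: lebesgue_measure_unique => _ [[u v]] _ <- /=.
rewrite /mscale /law /= /pushforward aff_ocitv muleA -EFinM divff ?mul1e//.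
by rewrite normr_eq0.
Qed.

Lemma integral_lebesgue_affine (f : R -> \bar R) :
  measurable_fun setT f -> (forall x, 0 <= f x)%E ->
  (\int[mu]_x f x = `|a|%:E * \int[mu]_x f (a * x + b)%R)%E.
Proof.
move=> mf f0.
transitivity (\int[mscale (NngNum normV_ge0) law]_x f x)%E.
  by apply: eq_measure_integral => A mA _; exact: pushforward_aff.
rewrite ge0_integral_mscale//; congr (_ * _)%E.
by rewrite (@ge0_integral_pushforward _ _ _ _ _ _ measurable_aff).
Qed.

End lebesgue_affine.

Section gauss.
Context {R : realType}.
Notation mu := (@lebesgue_measure R).
Notation N := (normal_prob (0 : R) 1).

Lemma integral_normal_prob (m s : R) (h : R -> \bar R) :
  measurable_fun setT h -> (forall x, 0 <= h x)%E ->
  (\int[normal_prob m s]_x h x = \int[mu]_x (h x * (normal_pdf m s x)%:E))%E.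
Proof.
move=> mh h0.
have dom := normal_prob_dominates m s.
rewrite -(Radon_Nikodym_SigmaFinite.change_of_variables dom)//.
set g := Radon_Nikodym_SigmaFinite.f _ _.
have ig : mu.-integrable setT g := Radon_Nikodym_SigmaFinite.f_integrable dom.
have mpdf : measurable_fun setT (fun x => (normal_pdf m s x)%:E).
  by apply/measurable_EFinP; exact: measurable_normal_pdf.
apply: ge0_ae_eq_integral => //.
- apply: emeasurable_funM => //; exact: measurable_int ig.
- exact: emeasurable_funM.
- by move=> x _; rewrite mule_ge0//; exact: Radon_Nikodym_SigmaFinite.f_ge0.
- by move=> x _; rewrite mule_ge0// lee_fin normal_pdf_ge0.
- have : ae_eq mu setT g (fun x => (normal_pdf m s x)%:E).
    apply: integral_ae_eq => // E _ mE.
    by rewrite -(Radon_Nikodym_SigmaFinite.f_integral dom).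
  by apply: filterS => x /= ->.
Qed.

Lemma normal_prob_indic (m s : R) (A : set R) :
  (normal_prob m s A = \int[mu]_x (\1_A x * normal_pdf m s x)%:E)%E.
Proof.
rewrite /normal_prob integral_mkcond; apply: eq_integral => x _.
by rewrite patchE indicE; case: ifP; rewrite ?mul1r ?mul0r.
Qed.

Lemma measurable_indic_normal_pdf (m s : R) (A : set R) : measurable A ->
  measurable_fun setT (fun x => (\1_A x * normal_pdf m s x)%:E).
Proof.
move=> mA; apply/measurable_EFinP; apply: measurable_funM => //.
exact: measurable_normal_pdf.
Qed.

Lemma normal_scale (s : R) (B : set R) : s != 0 -> measurable B ->
  N [set x | B (s * x)] = normal_prob 0 s B.
Proof.
move=> s0 mB.
rewrite !normal_prob_indic [RHS](@integral_lebesgue_affine _ s 0)//; last 2 first.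
- exact: measurable_indic_normal_pdf.
- by move=> x; rewrite lee_fin mulr_ge0// normal_pdf_ge0.
rewrite -ge0_integralZl//; last 2 first.
- by apply: (measurableT_comp (measurable_indic_normal_pdf 0 s mB)) => //; apply: measurable_funD => //; exact: measurable_funM.
- by move=> x _; rewrite lee_fin mulr_ge0// normal_pdf_ge0.
apply: eq_integral => x _; rewrite -EFinM; congr (_%:E).
rewrite addr0 mulrCA !indicE; congr (_ * _).
rewrite !normal_pdfE ?oner_neq0//= /normal_peak /normal_fun !subr0 mulrA.
congr (_ * _).
  rewrite expr1n mul1r -mulrnAr sqrtrM ?sqr_ge0// sqrtr_sqr invfM mulrA divff ?mul1r//.
  by rewrite normr_eq0.
congr expR; rewrite exprMn !mulNr; congr (- _); field.
by [].
Qed.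

(** Completing the square: the conditional law of [x] given the sum [y] is
   normal with mean [y a^2 / c^2] and standard deviation [a b / c]. *)
Lemma normal_pdf_mul (a b x y : R) : a != 0 -> b != 0 ->
  let c := Num.sqrt (a ^+ 2 + b ^+ 2) in
  normal_pdf 0 a x * normal_pdf 0 b (y - x) =
  normal_pdf 0 c y * normal_pdf (y * a ^+ 2 / c ^+ 2) (a * b / c) x.
Proof.
move=> a0 b0 c.
have a20 : 0 < a ^+ 2 by rewrite exprn_even_gt0.
have b20 : 0 < b ^+ 2 by rewrite exprn_even_gt0.
have c2 : c ^+ 2 = a ^+ 2 + b ^+ 2 by rewrite sqr_sqrtr// ltW// addr_gt0.
have c0 : c != 0 by rewrite gt_eqF// sqrtr_gt0 addr_gt0.
have s0 : a ^+ 2 + b ^+ 2 != 0 by rewrite gt_eqF// addr_gt0.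
rewrite !normal_pdfE//; last by rewrite !mulf_neq0// invr_eq0.
rewrite /normal_peak /normal_fun mulrACA -expRD [RHS]mulrACA -expRD; congr (_ * expR _).
  rewrite -!invfM -!sqrtrM; last 2 first.
  - by rewrite mulrn_wge0// mulr_ge0 ?sqr_ge0 ?pi_ge0.
  - by rewrite mulrn_wge0// mulr_ge0 ?sqr_ge0 ?pi_ge0.
  congr (Num.sqrt _)^-1; rewrite !expr_div_n exprMn c2; field.
  by rewrite s0.
rewrite !expr_div_n exprMn c2; field.
by rewrite s0 a0 b0.
Qed.

(** After translating the inner variable and exchanging the integrals,
   [normal_pdf_mul] leaves the total mass of a normal density. *)
Lemma normal_convolution (a b : R) (B : set R) : a != 0 -> b != 0 -> measurable B ->
  (\int[normal_prob 0 a]_x normal_prob (0 : R) b [set y : R | B ((x : R) + y)%R] =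
   normal_prob 0 (Num.sqrt (a ^+ 2 + b ^+ 2)) B)%E.
Proof.
move=> a0 b0 mB; set c := Num.sqrt _.
have c0 : c != 0.
  by rewrite gt_eqF// sqrtr_gt0 addr_gt0// exprn_even_gt0.
pose g (xy : R * R) := (\1_B xy.2 * normal_pdf 0 b (xy.2 - xy.1))%:E.
have mg : measurable_fun setT g.
  apply/measurable_EFinP; apply: measurable_funM.
    by apply: measurableT_comp.
  apply: (measurableT_comp (measurable_normal_pdf 0 b)).
  by apply: measurable_funB.
have g0 xy : (0 <= g xy)%E by rewrite lee_fin mulr_ge0// normal_pdf_ge0.
have shift (x : R) : normal_prob 0 b [set y : R | B (x + y)] = (\int[mu]_y g (x, y))%E.
  rewrite normal_prob_indic [RHS](@integral_lebesgue_affine _ 1 x)//; last first.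
    by apply: measurableT_comp.
  rewrite normr1 mul1e; apply: eq_integral => y _.
  by rewrite /g /= mul1r addrK !indicE [y + x]addrC.
under eq_integral do rewrite shift.
have mG : measurable_fun setT (fun x => \int[mu]_y g (x, y))%E.
  exact: (measurable_fun_fubini_tonelli_F (m2 := mu) g).
rewrite integral_normal_prob//; last by move=> x; apply: integral_ge0.
pose k (xy : R * R) := (g xy * (normal_pdf 0 a xy.1)%:E)%E.
have mk : measurable_fun setT k.
  apply: emeasurable_funM => //; apply/measurable_EFinP.
  exact: (measurableT_comp (measurable_normal_pdf 0 a)).
have k0 xy : (0 <= k xy)%E by rewrite mule_ge0// lee_fin normal_pdf_ge0.
transitivity (\int[mu]_x \int[mu]_y k (x, y))%E.
  apply: eq_integral => x _; rewrite /k /= ge0_integralZr//.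
  - by apply: measurableT_comp.
  - by rewrite lee_fin normal_pdf_ge0.
apply: (eq_trans (fubini_tonelli (m1 := mu) (m2 := mu) k mk k0)).
rewrite normal_prob_indic; apply: eq_integral => y _.
transitivity (\int[mu]_x ((\1_B y * normal_pdf 0 c y)%:E *
    (normal_pdf (y * a ^+ 2 / c ^+ 2) (a * b / c) x)%:E))%E.
  apply: eq_integral => x _; rewrite /k /g /= -!EFinM; congr (_%:E).
  by rewrite -[LHS]mulrA [normal_pdf 0 b _ * _]mulrC normal_pdf_mul// mulrA.
rewrite ge0_integralZl_EFin ?integral_normal_pdf ?mule1//.
- by move=> x _; rewrite lee_fin normal_pdf_ge0.
- by apply/measurable_EFinP; exact: measurable_normal_pdf.
- by rewrite mulr_ge0// normal_pdf_ge0.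
Qed.

End gauss.

Section gauss_laws.
Context {R : realType}.
Notation N := (normal_prob (0 : R) 1).
Implicit Types (B : set R).

Lemma measurable_affine_preimage (a b : R) B : measurable B ->
  measurable [set x | B (a + b * x)].
Proof.
move=> mB; rewrite -[X in measurable X]setTI.
have : measurable_fun setT (fun x : R => a + b * x).
  by apply: measurable_funD => //; exact: measurable_funM.
by move=> /(_ measurableT _ mB).
Qed.

Lemma measurable_scale_preimage (a : R) B : measurable B ->
  measurable [set x | B (a * x)].
Proof.
move=> /(measurable_affine_preimage 0 a); congr measurable.
by apply/funext => x /=; rewrite add0r.
Qed.

Lemma normal_prob_norm (s : R) B : s != 0 -> normal_prob 0 `|s| B = normal_prob 0 s B.
Proof.
move=> s0; rewrite /normal_prob; apply: eq_integral => x _; congr EFin.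
by rewrite !normal_pdfE ?normr_eq0// /normal_peak /normal_fun real_normK ?num_real.
Qed.

Lemma normal_scale_norm (s : R) B : measurable B ->
  N [set x | B (`|s| * x)] = N [set x | B (s * x)].
Proof.
move=> mB; have [->|s0] := eqVneq s 0; first by rewrite normr0.
have ns0 : `|s| != 0 by rewrite normr_eq0.
by rewrite (normal_scale s0 mB) (normal_scale ns0 mB) normal_prob_norm.
Qed.

(** The form of [normal_convolution] that allows vanishing coefficients, where
   the summands are degenerate. *)
Lemma normal_linear2 (a r : R) B : measurable B ->
  (\int[N]_x N [set y : R | B (a * (x : R) + r * y)%R] =
   N [set x : R | B (Num.sqrt (a ^+ 2 + r ^+ 2) * x)%R])%E.
Proof.
move=> mB.
have [->|a0] := eqVneq a 0.
  rewrite expr0n add0r sqrtr_sqr normal_scale_norm//.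
  under eq_integral do under eq_set do rewrite mul0r add0r.
  rewrite integral_cst// -[RHS]mule1; congr (_ * _)%E; exact: (probability_setT N).
have [->|r0] := eqVneq r 0.
  rewrite expr0n addr0 sqrtr_sqr normal_scale_norm//.
  have mB' := measurable_scale_preimage a mB.
  rewrite -[in RHS](setIT [set x | B (a * x)]) -integral_indic//.
  apply: eq_integral => x _; rewrite indicE.
  under eq_set do rewrite mul0r addr0.
  case: (pselect (B (a * x))) => Bax.
    rewrite mem_set// (_ : [set _ | _] = setT) ?probability_setT//.
    by apply/seteqP; split.
  rewrite memNset// (_ : [set _ | _] = set0) ?measure0//.
  by apply/seteqP; split.
have mshift (t : R) : measurable [set y | B (t + y)].
  have := measurable_affine_preimage t 1 mB; congr measurable.
  by apply/funext => y /=; rewrite mul1r.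
transitivity (\int[N]_x normal_prob (0 : R) r [set y : R | B (a * (x : R) + y)%R])%E.
  apply: eq_integral => x _; exact: (normal_scale r0 (mshift (a * (x : R)))). 
rewrite normal_scale//; last by rewrite gt_eqF// sqrtr_gt0 addr_gt0// exprn_even_gt0.
apply: eq_trans (normal_convolution a0 r0 mB).
have ma : measurable_fun setT (fun x : measurableTypeR R => (a * (x : R) : measurableTypeR R)).
  by apply: measurable_funM.
pose pm : {measure set (measurableTypeR R) -> \bar R} :=
  measure_function_pushforward__canonical__measure_function_Measure N ma.
pose g (t : R) := normal_prob (0 : R) r [set y : R | B (t + y)%R].
have mg : measurable_fun setT g.
  have mS : measurable [set ty : R * R | B (ty.1 + ty.2)].
    rewrite -[X in measurable X]setTI.
    have : measurable_fun setT (fun ty : R * R => ty.1 + ty.2).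
      by apply: measurable_funD.
    by move=> /(_ measurableT _ mB).
  have := measurable_fun_xsection (normal_prob 0 r) mS.
  congr measurable_fun; apply/funext => t /=; rewrite /g; congr (normal_prob 0 r _).
  by apply/seteqP; split => y; rewrite /xsection /= inE.
transitivity (\int[pm]_x g x)%E.
  by rewrite (@ge0_integral_pushforward _ _ _ _ _ _ ma).
apply: eq_measure_integral => A mA _ /=.
by rewrite -normal_scale.
Qed.

Lemma measurable_sum_tnth p (c : 'I_p -> R) :
  measurable_fun [set: p.-tuple R] (fun z => \sum_(i < p) c i * tnth z i).
Proof.
apply: measurable_sum => i; apply: measurable_funM => //; exact: measurable_tnth.
Qed.

(** The normal law lives on the line with its Borel structure, whereas tuples
   are built over the default structure of [R].  Their measurable sets coincide
   but their displays differ; [stdgauss] is the transport along the identity. *)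
Let idR (x : measurableTypeR R) : R := x.

Let measurable_idR : measurable_fun setT idR.
Proof. exact: measurable_id. Qed.

Let idRV : {mfun measurableTypeR R >-> R} :=
  HB.pack idR (isMeasurableFun.Build _ _ _ _ idR measurable_idR).

Definition stdgauss : probability R R := distribution N idRV.

Lemma integral_stdgauss (h : R -> \bar R) : measurable_fun setT h ->
  (forall x, 0 <= h x)%E -> (\int[stdgauss]_x h x = \int[N]_x h x)%E.
Proof. by move=> mh h0; rewrite ge0_integral_distribution. Qed.

(** By induction on the dimension, peeling off one coordinate at a time: this
   is the rotation invariance of the standard normal law. *)
Lemma gauss_linear_law p (Q : probability (p.-tuple R) R) (c : 'I_p -> R) B :
  power_law stdgauss Q -> measurable B ->
  Q [set z | B (\sum_(i < p) c i * tnth z i)] =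
  N [set x | B (Num.sqrt (\sum_(i < p) c i ^+ 2) * x)].
Proof.
elim: p Q c B => [|p IHp] Q c B QE mB.
  rewrite big_ord0 sqrtr0.
  under eq_set do rewrite big_ord0.
  under [in RHS]eq_set do rewrite mul0r.
  case: (pselect (B 0)) => B0.
    rewrite (_ : [set _ | _] = setT) ?probability_setT; last by apply/seteqP; split.
    by rewrite (_ : [set _ | _] = setT) ?probability_setT//; apply/seteqP; split.
  rewrite (_ : [set _ | _] = set0) ?measure0; last by apply/seteqP; split.
  by rewrite (_ : [set _ | _] = set0) ?measure0//; apply/seteqP; split.
have [Q' Q'E] := power_law_behead QE.
have mS : measurable [set z : p.+1.-tuple R | B (\sum_(i < p.+1) c i * tnth z i)].
  rewrite -[X in measurable X]setTI.
  by apply: (measurable_sum_tnth c) => //; exact: measurableT.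
rewrite -[in LHS](setIT [set z | B _]) -integral_indic//.
rewrite (integral_power_law_cons QE Q'E)//; last first.
  by apply/measurable_EFinP; exact: measurable_indic.
rewrite big_ord_recl /= -[\sum_(i < p) _]sqr_sqrtr; last first.
  by apply: sumr_ge0 => i _; exact: sqr_ge0.
rewrite -normal_linear2//.
have mh : measurable_fun setT (fun x : R =>
    \int[Q']_z (\1_[set z : p.+1.-tuple R | B (\sum_(i < p.+1) c i * tnth z i)]
      [tuple of x :: z])%:E)%E.
  pose f := fun xz : R * p.-tuple R => [the p.+1.-tuple R of xz.1 :: xz.2].
  have mf : measurable_fun setT f by apply: measurable_cons.
  apply: (measurable_fun_fubini_tonelli_F (m2 := Q') (fun xz => (\1_[set z : p.+1.-tuple R |
      B (\sum_(i < p.+1) c i * tnth z i)] (f xz))%:E)) => //.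
  by apply/measurable_EFinP; apply: measurableT_comp.
rewrite integral_stdgauss//; last by move=> x; apply: integral_ge0 => z _; rewrite lee_fin.
apply: eq_integral => x _.
rewrite -[RHS](IHp Q' (fun i => c (lift ord0 i)) [set y | B (c ord0 * x + y)])//; last first.
  have := measurable_affine_preimage (c ord0 * x) 1 mB; congr measurable.
  by apply/funext => y /=; rewrite mul1r.
have mS' : measurable [set z : p.-tuple R |
    B (c ord0 * x + \sum_(i < p) c (lift ord0 i) * tnth z i)].
  rewrite -[X in measurable X]setTI.
  have : measurable_fun setT (fun z : p.-tuple R =>
      c ord0 * x + \sum_(i < p) c (lift ord0 i) * tnth z i).
    by apply: measurable_funD => //; exact: measurable_sum_tnth.
  by move=> /(_ measurableT _ mB).
rewrite -[in RHS](setIT [set z | B _]) -integral_indic//.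
have E (z : p.-tuple R) : \sum_(i < p.+1) c i * tnth [tuple of (x : R) :: z] i =
           c ord0 * x + \sum_(i < p) c (lift ord0 i) * tnth z i.
  by rewrite big_ord_recl; congr (_ + _); apply: eq_bigr => i _; rewrite tnthS.
apply: eq_integral => z _; rewrite !indicE /=; congr ((nat_of_bool _)%:R%:E).
by apply/idP/idP; rewrite !inE /= E.
exact: measurableT.
Qed.

Lemma dotpE p (u : 'cV[R]_p) (x : p.-tuple R) :
  dotp u x = \sum_(i < p) u i 0 * tnth x i.
Proof. by rewrite /dotp mxE; apply: eq_bigr => i _; rewrite !mxE. Qed.

Lemma dotp_mulmxt p (L : 'M[R]_p) (u : 'cV[R]_p) (z : p.-tuple R) :
  dotp u (mulmxt L z) = dotp (L^T *m u) z.
Proof.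
rewrite /dotp trmx_mul trmxK -mulmxA; congr ((_ *m _) 0 0).
by apply/colP => i; rewrite mxE tnth_mktuple.
Qed.

Lemma measurable_dotp p (u : 'cV[R]_p) : measurable_fun [set: p.-tuple R] (dotp u).
Proof.
rewrite (_ : dotp u = fun z => \sum_(i < p) u i 0 * tnth z i); last first.
  by apply/funext => z; rewrite dotpE.
exact: (measurable_sum_tnth (fun i => u i 0)).
Qed.

Lemma enorm_sqr p (u : 'cV[R]_p) : enorm u ^+ 2 = \sum_(i < p) u i 0 ^+ 2.
Proof. by rewrite sqr_sqrtr// sumr_ge0// => i _; exact: sqr_ge0. Qed.

Lemma qform_gram p (L : 'M[R]_p) (u : 'cV[R]_p) :
  qform (L *m L^T) u = enorm (L^T *m u) ^+ 2.
Proof.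
rewrite enorm_sqr /qform !mulmxA -(mulmxA (_ *m L)) mxE; apply: eq_bigr => i _.
by rewrite -[u^T *m L]trmxK trmx_mul trmxK mxE expr2.
Qed.

Lemma normal_vec_dotp p (Sigma : 'M[R]_p) (P0 : probability (p.-tuple R) R)
    (u : 'cV[R]_p) B :
  normal_vec Sigma P0 -> measurable B ->
  P0 [set x | B (dotp u x)] = N [set x | B (Num.sqrt (qform Sigma u) * x)].
Proof.
move=> [L [Q [<- QE P0E]]] mB.
rewrite P0E; last first.
  by rewrite -[X in measurable X]setTI; exact: measurable_dotp.
rewrite qform_gram /enorm sqr_sqrtr; last by rewrite sumr_ge0// => i _; exact: sqr_ge0.
rewrite -(gauss_linear_law (fun i => (L^T *m u) i 0) QE)//; congr (Q _).
by apply/seteqP; split=> z /=; rewrite dotp_mulmxt dotpE.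
Qed.

End gauss_laws.

(** * Estimates for the standard normal law *)

Section gauss_bounds.
Context {R : realType}.
Notation mu := (@lebesgue_measure R).
Notation N := (normal_prob (0 : R) 1).
Notation phi := (normal_pdf (0 : R) 1).

Lemma measurable_norm_itv (I : interval R) : measurable [set y : R | `|y| \in I].
Proof.
have := @normr_measurable R setT measurableT _ (measurable_itv I).
by rewrite setTI.
Qed.

Lemma measurable_norm_band (t a : R) : measurable [set y : R | `| `|y| - t| <= a].
Proof.
have := measurable_norm_itv `[t - a, t + a]; congr measurable.
by apply/seteqP; split=> y /=; rewrite in_itv/= ler_distl.
Qed.

Lemma measurable_norm_le (a : R) : measurable [set y : R | `|y| <= a].
Proof. exact: (measurable_norm_itv `]-oo, a]). Qed.

Lemma measurable_norm_ge (a : R) : measurable [set y : R | a <= `|y|].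
Proof.
have := measurable_norm_itv `[a, +oo[; congr measurable.
by apply/seteqP; split=> y /=; rewrite in_itv/= andbT.
Qed.

Lemma measurable_norm_lt (a : R) : measurable [set y : R | `|y| < a].
Proof. exact: (measurable_norm_itv `]-oo, a[). Qed.

Lemma measurable_norm_gt (a : R) : measurable [set y : R | a < `|y|].
Proof.
have := measurable_norm_itv `]a, +oo[; congr measurable.
by apply/seteqP; split=> y /=; rewrite in_itv/= andbT.
Qed.

Lemma normal_pdf_le_half (x : R) : phi x <= 2^-1.
Proof.
apply: (le_trans (normal_pdf_ub _ _ (oner_neq0 _))).
rewrite /normal_peak expr1n mul1r.
have pi2 : 2 <= pi :> R := pi_ge2 R.
have p2 : 0 < pi *+ 2 :> R by rewrite mulr2n; lra.
rewrite lef_pV2 ?posrE ?sqrtr_gt0//.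
have -> : 2 = Num.sqrt (2 ^+ 2) :> R by rewrite sqrtr_sqr ger0_norm.
by rewrite ler_sqrt ?(ltW p2)// expr2 [pi *+ 2]mulr2n; lra.
Qed.

Lemma normal_itv_le (u v : R) : u <= v -> (N `[u, v] <= ((v - u) / 2)%:E)%E.
Proof.
move=> uv; rewrite /normal_prob.
apply: (@le_trans _ _ (\int[mu]_(x in `[u, v]) (2^-1)%:E)%E).
  apply: ge0_le_integral => //.
  - by move=> x _; rewrite lee_fin normal_pdf_ge0.
  - apply: measurable_funTS; apply/measurable_EFinP; exact: measurable_normal_pdf.
  - by move=> x _; rewrite lee_fin normal_pdf_le_half.
rewrite integral_cst//= lebesgue_measure_itv/= lte_fin -EFinB.
case: ltP => uv'; rewrite -?EFinM ?mule0 lee_fin; lra.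
Qed.

(** Two intervals of length [2 a / r], and a density at most [1 / 2]. *)
Lemma normal_band_le (r t a : R) : 2^-1 <= r -> 0 <= a ->
  (N [set x : R | (`| `|r * x| - t | <= a)%R] <= (4 * a)%:E)%E.
Proof.
move=> r2 a0; have r0 : 0 < r by lra.
have H (s : R) : (N `[((s - a) / r)%R, ((s + a) / r)%R] <= (2 * a)%:E)%E.
  apply: (le_trans (normal_itv_le _)); first by rewrite ler_pM2r ?invr_gt0//; lra.
  rewrite lee_fin -mulrBl mulrAC ler_pdivrMr//.
  have : a * 2^-1 <= a * r by rewrite ler_wpM2l.
  lra.
apply: (@le_trans _ _ (N (`[(t - a) / r, (t + a) / r]%classic `|` `[(- t - a) / r, (- t + a) / r]%classic)%R)).
  apply: le_measure; rewrite ?inE.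
  - exact: (measurable_scale_preimage _ (measurable_norm_band t a)).
  - by apply: measurableU; exact: measurable_itv.
  - move=> x /=; rewrite !in_itv/= !ler_pdivrMr// !ler_pdivlMr// ![x * r]mulrC.
    rewrite ler_norml => /andP[h1 h2].
    case: (ger0P (r * x)) h1 h2 => rx h1 h2; [left|right]; apply/andP; split; lra.
apply: (le_trans (measureU2 _ _ _)); rewrite ?measurable_itv//.
apply: (le_trans (leeD (H t) (H (- t)))); rewrite -EFinD lee_fin; lra.
Qed.

(** [exp (x^2 / 4)] times the standard normal density is [sqrt 2] times the
   normal density of variance 2. *)
Lemma normal_exp_moment : (\int[N]_x (expR (x ^+ 2 / 4))%:E <= 2%:E)%E.
Proof.
rewrite integral_normal_prob; last 2 first.
- apply/measurable_EFinP; apply: measurableT_comp => //.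
  by apply: measurable_funM => //; exact: measurable_funX.
- by move=> x; rewrite lee_fin expR_ge0.
pose s := Num.sqrt (2 : R).
have s2 : s ^+ 2 = 2 by rewrite sqr_sqrtr.
have s_gt0 : 0 < s by rewrite sqrtr_gt0.
rewrite (_ : (\int[mu]_x _)%E = (\int[mu]_x (s%:E * (normal_pdf 0 s x)%:E))%E); last first.
  apply: eq_integral => x _; rewrite -!EFinM; congr (_%:E).
  rewrite !normal_pdfE ?oner_neq0 ?gt_eqF//= /normal_peak /normal_fun !subr0.
  rewrite [LHS]mulrCA -expRD [RHS]mulrA.
  rewrite s2 expr1n mul1r -mulrnAr sqrtrM// -/s invfM mulrA divff ?mul1r ?gt_eqF//.
  congr (_ * expR _); by field.
have mpdf : measurable_fun setT (fun x => (normal_pdf 0 s x)%:E).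
  by apply/measurable_EFinP; exact: measurable_normal_pdf.
rewrite ge0_integralZl_EFin ?(ltW s_gt0)//; last first.
  by move=> x _; rewrite lee_fin normal_pdf_ge0.
by rewrite integral_normal_pdf mule1 lee_fin; nra.
Qed.

(** Markov's inequality with [y <= exp y] for [y = x^2 / 4].  A polynomial tail
   suffices for the chaining. *)
Lemma normal_tail_le (r a : R) : 0 < a ->
  (N [set x : R | (a < `|r * x|)%R] <= (8 * r ^+ 2 / a ^+ 2)%:E)%E.
Proof.
move=> a0.
have mS : measurable [set x : R | a < `|r * x|].
  exact: (measurable_scale_preimage _ (measurable_norm_gt a)).
rewrite -[X in N X](setIT) -integral_indic//.
have -> : (8 * r ^+ 2 / a ^+ 2)%:E = ((4 * r ^+ 2 / a ^+ 2)%:E * 2%:E)%E.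
  by rewrite -EFinM; congr (_%:E); field; rewrite gt_eqF.
have c0 : 0 <= 4 * r ^+ 2 / a ^+ 2.
  by rewrite mulr_ge0 ?invr_ge0 ?sqr_ge0// mulr_ge0 ?sqr_ge0.
have mexp : measurable_fun setT (fun x : R => (expR (x ^+ 2 / 4))%:E).
  apply/measurable_EFinP; apply: measurableT_comp => //.
  by apply: measurable_funM => //; exact: measurable_funX.
apply: (@le_trans _ _ ((4 * r ^+ 2 / a ^+ 2)%:E * \int[N]_x (expR (x ^+ 2 / 4))%:E)%E).
  rewrite -ge0_integralZl_EFin//.
  apply: ge0_le_integral => //.
  - by apply/measurable_EFinP; exact: measurable_indic.
  - exact: measurable_funeM.
  - move=> x _; rewrite -EFinM lee_fin indicE; case: (boolP (_ \in _)) => [|_]; last first.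
      by rewrite mulr_ge0// expR_ge0.
    rewrite inE /= => ax.
    have a2 : a ^+ 2 <= r ^+ 2 * x ^+ 2.
      by rewrite -exprMn -[leRHS]real_normK ?num_real// lerXn2r ?nnegrE ?(ltW a0) ?(ltW ax).
    apply: (@le_trans _ _ (4 * r ^+ 2 / a ^+ 2 * (x ^+ 2 / 4))).
      have -> : 4 * r ^+ 2 / a ^+ 2 * (x ^+ 2 / 4) = r ^+ 2 * x ^+ 2 / a ^+ 2.
        by field; rewrite gt_eqF.
      by rewrite ler_pdivlMr ?exprn_gt0// mul1r.
    rewrite ler_wpM2l//; apply: le_trans (expR_ge1Dx _); lra.
by rewrite lee_wpmul2l ?lee_fin// normal_exp_moment.
Qed.

End gauss_bounds.

Section Phi_theory.
Context {R : realType}.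
Notation mu := (@lebesgue_measure R).
Notation N := (normal_prob (0 : R) 1).
Notation phi := (normal_pdf (0 : R) 1).
Notation Phi := (@Phi R).
Notation Phi_inv := (@Phi_inv R).

Lemma PhiE (x : R) : N `]-oo, x] = (Phi x)%:E.
Proof. by rewrite fineK// fin_num_measure//; exact: measurable_itv. Qed.

Lemma normal_set1 (x : R) : N [set x] = 0%E.
Proof.
apply/eqP; rewrite eq_le measure_ge0 andbT.
have := normal_itv_le (lexx x); rewrite set_itv1 subrr mul0r; exact.
Qed.

Lemma PhiE_open (x : R) : N `]-oo, x[ = (Phi x)%:E.
Proof.
rewrite -PhiE -(@setUitv1 _ _ -oo%O x true)// measureU//=.
- by rewrite [X in (_ + X)%E]normal_set1 adde0.
- by apply/seteqP; split => y //= [] /[swap] ->; rewrite in_itv/= ltxx.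
Qed.

Lemma normal_itvoc (x y : R) : x <= y -> N `]x, y] = (Phi y - Phi x)%:E.
Proof.
move=> xy; have := PhiE y.
rewrite (@itv_bndbnd_setU _ _ -oo%O (BRight x))//.
rewrite measureU//=; last first.
  apply/seteqP; split => z //= []; rewrite !in_itv/= => zx /andP[xz _].
  by move: (lt_le_trans xz zx); rewrite ltxx.
rewrite PhiE -(fineK (fin_num_measure N _ (measurable_itv _))) -EFinD => -[<-].
by rewrite addrAC subrr add0r.
Qed.

Lemma Phi_sub_le (x y : R) : x <= y -> 0 <= Phi y - Phi x <= (y - x) / 2.
Proof.
move=> xy; rewrite -!lee_fin -normal_itvoc// measure_ge0/=.
apply: le_trans (normal_itv_le xy); apply: le_measure; rewrite ?inE//.
by move=> z /=; rewrite !in_itv/= => /andP[/ltW-> ->].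
Qed.

Lemma normal_pdf_decr (x y : R) : `|x| <= `|y| -> phi y <= phi x.
Proof.
move=> xy; rewrite !normal_pdfE ?oner_neq0// /normal_fun ler_wpM2l ?normal_peak_ge0//.
rewrite ler_expR !subr0 !mulNr lerN2 ler_pM2r ?invr_gt0 ?mulrn_wgt0 ?expr1n//.
by rewrite -(real_normK (num_real x)) -(real_normK (num_real y)) lerXn2r ?nnegrE.
Qed.

Lemma normal_pdf_gt0 (x : R) : 0 < phi x.
Proof.
by rewrite normal_pdfE ?oner_neq0// mulr_gt0 ?expR_gt0// normal_peak_gt0 ?oner_neq0.
Qed.

Lemma Phi_sub_ge (m x y : R) : - m <= x -> x <= y -> y <= m ->
  (y - x) * phi m <= Phi y - Phi x.
Proof.
move=> mx xy ym; rewrite -lee_fin -normal_itvoc// /normal_prob.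
apply: (@le_trans _ _ (\int[mu]_(z in `]x, y]) (phi m)%:E)%E).
  rewrite integral_cst//= lebesgue_measure_itv/= lte_fin.
  case: ltP => [_|yx]; first by rewrite -EFinB -EFinM mulrC.
  by rewrite mule0 (_ : y - x = 0) ?mul0r//; apply/eqP; rewrite subr_eq0 eq_le yx xy.
apply: ge0_le_integral => //.
- by move=> z _; rewrite lee_fin normal_pdf_ge0.
- apply: measurable_funTS; apply/measurable_EFinP; exact: measurable_normal_pdf.
- move=> z /=; rewrite in_itv/= => /andP[xz zy]; rewrite lee_fin normal_pdf_decr//.
  rewrite [X in _ <= X]ger0_norm; last by lra.
  by rewrite ler_norml; apply/andP; split; lra.
Qed.

Lemma Phi_lt (x y : R) : x < y -> Phi x < Phi y.
Proof.
move=> xy; rewrite -subr_gt0.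
have := @Phi_sub_ge (`|x| + `|y|) x y.
have := ler_norm (- x); have := ler_norm y; rewrite normrN => h1 h2.
have := normr_ge0 x; have := normr_ge0 y => h3 h4.
move=> /(_ ltac:(lra) (ltW xy) ltac:(lra)); apply: lt_le_trans.
by rewrite mulr_gt0 ?normal_pdf_gt0 ?subr_gt0.
Qed.

Lemma Phi_le (x y : R) : (Phi x <= Phi y) = (x <= y).
Proof.
case: (leP x y) => [xy|/Phi_lt]; first by have := Phi_sub_le xy; rewrite subr_ge0 => /andP[].
by rewrite ltNge => /negbTE.
Qed.

Lemma Phi_setC_open (x : R) : N (~` `]-oo, x[) = (1 - Phi x)%:E.
Proof.
rewrite probability_setC; last exact: measurable_itv.
by rewrite EFinB; congr (_ - _)%E; exact: PhiE_open.
Qed.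

Lemma PhiN (x : R) : Phi (- x) = 1 - Phi x.
Proof.
apply: EFin_inj; rewrite -Phi_setC_open -PhiE.
have m : measurable (~` `]-oo, x[ : set R) by apply: measurableC; exact: measurable_itv.
have := normal_scale_norm (-1) m; rewrite normrN normr1 => E.
transitivity (N [set y | (~` `]-oo, x[) (-1 * y)]).
  congr (N _); apply/seteqP; split => y /=; rewrite !in_itv/= mulN1r; lra.
by rewrite -E; congr (N _); apply/seteqP; split => y /=; rewrite mul1r.
Qed.

Lemma Phi0 : Phi 0 = 2^-1.
Proof. by have := PhiN 0; rewrite oppr0; lra. Qed.

Lemma normal_slab (t : R) : 0 <= t ->
  [/\ N [set x : R | (`|x| <= t)%R] = (2 * Phi t - 1)%:E,
      N [set x : R | (`|x| < t)%R] = (2 * Phi t - 1)%:E,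
      N [set x : R | (t <= `|x|)%R] = (2 - 2 * Phi t)%:E &
      N [set x : R | (t < `|x|)%R] = (2 - 2 * Phi t)%:E].
Proof.
move=> t0.
have mle : measurable [set x : R | `|x| <= t].
  rewrite (_ : [set _ | _] = `[- t, t]%classic); first exact: measurable_itv.
  by apply/seteqP; split => y /=; rewrite in_itv/= ler_norml.
have mlt : measurable [set x : R | `|x| < t].
  rewrite (_ : [set _ | _] = `]- t, t[%classic); first exact: measurable_itv.
  by apply/seteqP; split => y /=; rewrite in_itv/= ltr_norml.
have Ele : N [set x : R | (`|x| <= t)%R] = (2 * Phi t - 1)%:E.
  have := PhiE t.
  rewrite (_ : `]-oo, t]%classic = `]-oo, - t[%classic `|` [set x | `|x| <= t]); last first.
    apply/seteqP; split => y /=; rewrite !in_itv/= ler_norml.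
      by move=> yt; case: (ltP y (- t)) => h; [left|right].
    by case=> [h|/andP[]//]; lra.
  rewrite measureU//=; last first.
    apply/seteqP; split => y //= []; rewrite in_itv/= ler_norml => h1 /andP[h2 _]; lra.
  rewrite PhiE_open PhiN -(fineK (fin_num_measure N _ mle)) -EFinD => -[h].
  by congr (_%:E); lra.
have Elt : N [set x : R | (`|x| < t)%R] = (2 * Phi t - 1)%:E.
  have [t00|t_gt0] := leP t 0.
    have -> : t = 0 by apply/eqP; rewrite eq_le t00.
    rewrite Phi0 (_ : [set _ | _] = set0) ?measure0; last first.
      by apply/seteqP; split => y //=; rewrite ltNge normr_ge0.
    by congr (_%:E); field.
  have := PhiE_open t.
  rewrite (_ : `]-oo, t[%classic = `]-oo, - t]%classic `|` [set x | `|x| < t]); last first.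
    apply/seteqP; split => y /=; rewrite !in_itv/= ltr_norml.
      by move=> yt; case: (leP y (- t)) => h; [left|right].
    by case=> [h|/andP[]//]; lra.
  rewrite measureU//=; last first.
    apply/seteqP; split => y //= []; rewrite in_itv/= ltr_norml => h1 /andP[h2 _]; lra.
  rewrite PhiE PhiN -(fineK (fin_num_measure N _ mlt)) -EFinD => -[h].
  by congr (_%:E); lra.
have EC (A B : set R) (a : R) : measurable A -> B = ~` A -> N A = (2 * a - 1)%:E ->
    N B = (2 - 2 * a)%:E.
  move=> mA -> EA; rewrite probability_setC//.
  rewrite (_ : 2 - 2 * a = 1 - (2 * a - 1)); last by ring.
  by rewrite EFinB; congr (_ - _)%E; exact: EA.
split=> //.
- apply: EC Elt => //; apply/seteqP; split => y /=; [by move=> h /(le_lt_trans h); rewrite ltxx|].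
  by move=> /negP; rewrite -leNgt.
- apply: EC Ele => //; apply/seteqP; split => y /=; [by move=> h /(lt_le_trans h); rewrite ltxx|].
  by move=> /negP; rewrite -ltNge.
Qed.

(** Reflection at [b >= 0] maps [(b, b + y]] to points that are closer to 0,
   where the density is larger. *)
Lemma Phi_reflect (b y : R) : 0 <= b -> 0 <= y ->
  Phi (b + y) - Phi b <= Phi b - Phi (b - y).
Proof.
move=> b0 y0; rewrite -lee_fin -!normal_itvoc; [|lra..].
have mi (I : interval R) : measurable_fun setT (fun x => (\1_[set` I] x * phi x)%:E).
  by apply: measurable_indic_normal_pdf; exact: measurable_itv.
rewrite [leLHS]normal_prob_indic (@integral_lebesgue_affine _ (-1) (2 * b))//; last first.
  by move=> x; rewrite lee_fin mulr_ge0// normal_pdf_ge0.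
rewrite normrN normr1 mul1e.
apply: (@le_trans _ _ (N `[b - y, b])).
  rewrite normal_prob_indic.
  apply: ge0_le_integral => //.
  - by move=> x _; rewrite lee_fin mulr_ge0// normal_pdf_ge0.
  - apply: (measurableT_comp (mi `]b, b + y])).
    by apply: measurable_funD => //; exact: measurable_funM.
  - exact: mi.
  - move=> x _; rewrite lee_fin mulN1r !indicE.
    case: (boolP (_ \in _)) => [|_]; last first.
      by rewrite mul0r mulr_ge0// normal_pdf_ge0.
    rewrite inE/= in_itv/= => /andP[h1 h2].
    rewrite mem_set/=; last by rewrite in_itv/=; apply/andP; split; lra.
    rewrite !mul1r normal_pdf_decr//.
    have h : x <= - x + 2 * b by lra.
    by rewrite [leRHS]ger0_norm ?ler_norml; [apply/andP; split; lra|lra].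
apply: (@le_trans _ _ (N ([set b - y] `|` `]b - y, b]%classic))).
  apply: le_measure; rewrite ?inE.
  - exact: measurable_itv.
  - by apply: measurableU => //; exact: measurable_itv.
  - move=> x /=; rewrite !in_itv/= => /andP[h1 h2].
    by have [->|ne] := eqVneq x (b - y); [left|right; rewrite lt_neqAle eq_sym ne h1].
apply: (le_trans (measureU2 _ _ _)) => //.
by rewrite [X in (X + _)%E]normal_set1 add0e.
Qed.

Lemma Phi_continuous : continuous Phi.
Proof.
move=> x; apply/(@cvgrPdist_lt _ R^o) => e e0.
near=> y.
have H (u v : R) : u <= v -> `|Phi u - Phi v| <= v - u.
  move=> uv; have /andP[h1 h2] := Phi_sub_le uv.
  by rewrite distrC ger0_norm//; lra.
have : `|x - y| < e by near: y; apply/nbhs_normP; exists e.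
have [xy|/ltW yx] := leP x y.
  by apply: le_lt_trans; apply: (le_trans (H _ _ xy)); rewrite distrC ger0_norm//; lra.
by apply: le_lt_trans; rewrite distrC; apply: (le_trans (H _ _ yx)); rewrite ger0_norm//; lra.
Unshelve. all: by end_near.
Qed.

(** [Phi_inv] is a choice in a fibre of [Phi]; the fibre is inhabited by the
   intermediate value theorem between [Phi 0 = 1 / 2] and a point where the
   tail bound gives [Phi >= q]. *)
Lemma Phi_invK (q : R) : 2^-1 <= q < 1 -> Phi (Phi_inv q) = q /\ 0 <= Phi_inv q.
Proof.
move=> /andP[q2 q1].
have [x Px] : exists x, Phi x = q.
  pose a := 1 + 4 / (1 - q).
  have a1 : 1 <= a by rewrite lerDl divr_ge0//; lra.
  have a0 : 0 < a by lra.
  have qa : q <= Phi a.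
    have := @normal_tail_le R 1 a a0.
    have := normal_slab (ltW a0) => -[_ _ _ E].
    under eq_set do rewrite mul1r.
    rewrite E lee_fin expr1n mulr1 => h.
    have : 8 / a ^+ 2 <= 2 * (1 - q).
      rewrite ler_pdivrMr ?exprn_gt0//.
      have -> : 8 = 2 * (1 - q) * (4 / (1 - q)) by field; rewrite subr_eq0 gt_eqF.
      rewrite ler_wpM2l//; first by lra.
      have w0 : 0 <= 4 / (1 - q) by rewrite divr_ge0//; lra.
      by rewrite expr2 /a; move: (4 / _) w0 => w w0; nra.
    lra.
  have [||x _ xq] := @IVT R Phi 0 a q (ltW a0); last by exists x.
    exact/continuous_subspaceT/Phi_continuous.
  by rewrite ge_min le_max Phi0 q2 qa orbT.
have E : Phi (Phi_inv q) = q.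
  by rewrite /Phi_inv; apply: (xgetPex 0 (P := [set x | Phi x = q])); exists x.
by split=> //; rewrite -Phi_le E Phi0.
Qed.

End Phi_theory.

(** * Quadratic forms and the operator norm *)

Section linalg.
Context {R : realType} {p : nat}.
Implicit Types (u v w : 'cV[R]_p) (A : 'M[R]_p).

Definition bil A u w : R := (u^T *m A *m w) 0 0.

Lemma bilC A u w : A^T = A -> bil A u w = bil A w u.
Proof.
by move=> AT; rewrite /bil -[LHS](mxE trmx_key (fun i j => (u^T *m A *m w) j i)) -/(trmx _) !trmx_mul trmxK AT mulmxA.
Qed.

Lemma qformD A u w (c : R) : A^T = A ->
  qform A (u + c *: w) = qform A u + 2 * c * bil A u w + c ^+ 2 * qform A w.
Proof.
move=> AT; have := bilC u w AT; rewrite /qform /bil => E.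
have -> : (u + c *: w)^T = u^T + c *: w^T by rewrite linearD linearZ.
rewrite !mulmxDl !mulmxDr -!scalemxAl -!scalemxAr.
have addE (X Y : 'M[R]_1) : (X + Y) 0 0 = X 0 0 + Y 0 0 by rewrite mxE.
have scaleE a (X : 'M[R]_1) : (a *: X) 0 0 = a * X 0 0 by rewrite mxE.
rewrite !addE !scaleE -E; ring.
Qed.

Lemma qformZ A u (c : R) : qform A (c *: u) = c ^+ 2 * qform A u.
Proof.
rewrite /qform (_ : (c *: u)^T = c *: u^T); last by rewrite linearZ.
by rewrite -!scalemxAl -!scalemxAr scalerA mxE expr2.
Qed.

Lemma qform1 u : qform 1%:M u = enorm u ^+ 2.
Proof. by rewrite enorm_sqr /qform mulmx1 mxE; apply: eq_bigr => i _; rewrite mxE expr2. Qed.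

Lemma enorm_ge0 u : 0 <= enorm u. Proof. exact: sqrtr_ge0. Qed.

Lemma enorm_eq u (c : R) : 0 <= c -> enorm u ^+ 2 = c ^+ 2 -> enorm u = c.
Proof. by move=> c0 /eqP; rewrite eqrXn2 ?enorm_ge0// => /eqP. Qed.

Lemma enormZ u (c : R) : enorm (c *: u) ^+ 2 = c ^+ 2 * enorm u ^+ 2.
Proof. by rewrite -!qform1 qformZ. Qed.

Lemma enorm_parallelogram u w :
  enorm (u + w) ^+ 2 + enorm (u - w) ^+ 2 = 2 * (enorm u ^+ 2 + enorm w ^+ 2).
Proof.
have := qformD u w 1 (trmx1 R p); have := qformD u w (-1) (trmx1 R p).
by rewrite scale1r scaleN1r -!qform1 => -> ->; ring.
Qed.

Lemma enorm_subC u w : enorm (u - w) ^+ 2 = enorm (w - u) ^+ 2.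
Proof. by rewrite -opprB -scaleN1r enormZ sqrrN expr1n mul1r. Qed.

(** Working with squared norms, this replaces the triangle inequality. *)
Lemma enorm_sqrB_le u v w :
  enorm (u - w) ^+ 2 <= 2 * enorm (u - v) ^+ 2 + 2 * enorm (v - w) ^+ 2.
Proof.
have := enorm_parallelogram (u - v) (v - w).
have -> : u - v + (v - w) = u - w by rewrite addrA subrK.
have := sqr_ge0 (enorm (u - v - (v - w))); lra.
Qed.

Lemma enorm_sqr_le u v : enorm u ^+ 2 <= 2 * enorm (u - v) ^+ 2 + 2 * enorm v ^+ 2.
Proof. by have := enorm_sqrB_le u v 0; rewrite !subr0. Qed.

Lemma enorm_eq0 u : enorm u ^+ 2 = 0 -> u = 0.
Proof.
rewrite enorm_sqr => /eqP; rewrite psumr_eq0; last by move=> i _; exact: sqr_ge0.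
move=> /allP u0; apply/colP => i; rewrite mxE.
by have /(_ (mem_index_enum _)) := u0 i; rewrite /= sqrf_eq0 => /eqP.
Qed.

Lemma unit_sphere_neq0 u : unit_sphere u -> u != 0.
Proof.
move=> su; apply/eqP => u0; move: su; rewrite /unit_sphere /= u0 => e.
have := enorm_sqr (0 : 'cV[R]_p); rewrite e big1 => [|i _]; last by rewrite mxE expr0n.
by rewrite expr1n => /eqP; rewrite oner_eq0.
Qed.

Lemma unit_sphere_normalize u : u != 0 -> unit_sphere ((enorm u)^-1 *: u) /\ 0 < enorm u.
Proof.
move=> u0; have n0 : 0 < enorm u.
  rewrite lt_neqAle enorm_ge0 andbT; apply: contra_neq u0 => e0.
  by apply: enorm_eq0; rewrite -e0 expr0n.
by split=> //; apply: enorm_eq => //; rewrite enormZ -exprMn mulVf ?gt_eqF.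
Qed.

Lemma qform_le_sphere A (k : R) : (forall u, unit_sphere u -> qform A u <= k) ->
  forall u, qform A u <= k * enorm u ^+ 2.
Proof.
move=> Ak u; have [->|u0] := eqVneq u 0.
  have -> : 0 = 0 *: u by rewrite scale0r.
  by rewrite qformZ enormZ expr0n !mul0r mulr0.
have [su n0] := unit_sphere_normalize u0.
have := Ak _ su; rewrite qformZ exprVn mulrC ler_pdivrMr ?exprn_gt0//.
Qed.

(** Polarisation: with [w = A u / |A u|], the norm [|A u|] is the bilinear form
   at [(w, u)], hence a quarter of the difference of the quadratic form at
   [w + u] and [w - u]. *)
Lemma opnorm_sym_le A (k : R) : (0 < p)%N -> A^T = A ->
  (forall u, unit_sphere u -> `|qform A u| <= k) -> opnorm A <= k.
Proof.
move=> p0 AT Ak.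
have qle u : qform A u <= k * enorm u ^+ 2.
  by apply: qform_le_sphere => {}u /Ak; apply: le_trans; exact: ler_norm.
have qge u : - qform A u <= k * enorm u ^+ 2.
  have qN w : - qform A w = qform (- A) w by rewrite /qform mulmxN mulNmx [RHS]mxE.
  rewrite qN; apply: qform_le_sphere => {}u /Ak; apply: le_trans.
  by rewrite -qN -normrN; exact: ler_norm.
have e1 : unit_sphere (delta_mx (Ordinal p0) 0 : 'cV[R]_p).
  apply: enorm_eq => //; rewrite enorm_sqr (bigD1 (Ordinal p0))//= !mxE !eqxx expr1n.
  rewrite big1 ?addr0// => i /negbTE ni; by rewrite mxE ni expr0n.
apply: ge_sup; first by eexists; exists (delta_mx (Ordinal p0) 0).
move=> _ [u su <-]; have [Au0|Au0] := eqVneq (A *m u) 0.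
  rewrite Au0 (_ : enorm 0 = 0); first exact: le_trans (Ak _ su).
  by apply: enorm_eq => //; rewrite enorm_sqr big1 ?expr0n// => i _; rewrite mxE expr0n.
have [sw n0] := unit_sphere_normalize Au0; set w := _ *: _ in sw.
have E : enorm (A *m u) = bil A w u.
  rewrite /bil -mulmxA /w (_ : (_ *: (A *m u))^T = (enorm (A *m u))^-1 *: (A *m u)^T); last by rewrite linearZ.
  rewrite -scalemxAl mxE.
  have -> : ((A *m u)^T *m (A *m u)) 0 0 = enorm (A *m u) ^+ 2.
    by rewrite -qform1 /qform mulmx1.
  by rewrite expr2 mulKf ?gt_eqF.
have D1 := qformD w u 1 AT; have D2 := qformD w u (-1) AT.
have P := enorm_parallelogram w u.
have := qle (w + 1 *: u); have := qge (w + (-1) *: u).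
rewrite D1 D2 scale1r scaleN1r E; move: P; rewrite su sw expr1n.
have := qle u; have := qge u.
set a := enorm (w + u) ^+ 2; set b := enorm (w - u) ^+ 2 => _ _ P h1 h2.
have : 4 * bil A w u <= k * (a + b) by rewrite mulrDr; lra.
by rewrite P; lra.
Qed.

Lemma opnorm_ge0 A : 0 <= opnorm A.
Proof.
rewrite /opnorm; set E := [set _ | _ in _].
have [supE|/sup_out->//] := pselect (has_sup E).
have [[x Ex] Eub] := supE; apply: (@le_trans _ _ x); last exact: ub_le_sup.
by case: Ex => u _ <-; exact: enorm_ge0.
Qed.

Definition entry_sum A : R := \sum_i \sum_j `|A i j|.

Lemma qform_entry_sum A u : unit_sphere u -> `|qform A u| <= entry_sum A.
Proof.
move=> su.
have u1 i : `|u i 0| <= 1.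
  have : u i 0 ^+ 2 <= 1.
    have := enorm_sqr u; rewrite su expr1n => ->.
    by rewrite (bigD1 i)//= lerDl sumr_ge0// => j _; exact: sqr_ge0.
  by rewrite -real_normK ?num_real// expr_le1.
rewrite /qform mxE; apply: (le_trans (ler_norm_sum _ _ _)).
rewrite /entry_sum exchange_big /=; apply: ler_sum => j _.
rewrite mxE normrM; apply: (@le_trans _ _ (`|\sum_i u^T 0 i * A i j| * 1)).
  by rewrite ler_wpM2l.
rewrite mulr1; apply: (le_trans (ler_norm_sum _ _ _)); apply: ler_sum => i _.
by rewrite normrM mxE ler_piMl.
Qed.

(** The supremum [m] of the Rayleigh quotient is an eigenvalue: otherwise
   [S = m - A] is positive semidefinite and invertible, and nonnegativity of the
   form of [S] at [w - K^-1 S^-1 w], with [K] a bound on the form of [S^-1],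
   keeps the quotient below [m - K^-1].  This avoids the compactness of the
   sphere and the spectral theorem. *)
Lemma qform_le_eigenvalue_bound A (M : R) : (0 < p)%N -> A^T = A ->
  (forall a, eigenvalue A a -> a < M) -> forall u, unit_sphere u -> qform A u <= M.
Proof.
move=> p0 AT eigM u su.
pose E : set R := [set qform A w | w in unit_sphere].
have Eub : has_ubound E.
  by exists (entry_sum A) => _ [w sw <-]; apply: le_trans (qform_entry_sum A sw); exact: ler_norm.
have E0 : E !=set0 by exists (qform A u), u.
pose m := sup E; pose S := m%:M - A.
have qS w : qform S w = m * enorm w ^+ 2 - qform A w.
  have subE a (X Y : 'M[R]_1) : (a *: X - Y) 0 0 = a * X 0 0 - Y 0 0 by rewrite !mxE.
  by rewrite -qform1 /qform mulmx1 /S mulmxBr mulmxBl mul_mx_scalar -scalemxAl subE.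
have ST : S^T = S by rewrite /S linearB /= tr_scalar_mx AT.
have S0 w : 0 <= qform S w.
  rewrite qS subr_ge0; apply: qform_le_sphere => {}w sw.
  by apply: ub_le_sup => //; exists w.
have um w : unit_sphere w -> qform A w <= m by move=> sw; apply: ub_le_sup => //; exists w.
have [Sunit|Snu] := boolP (S \in unitmx); last first.
  apply: (le_trans (um u su)); apply/ltW/eigM.
  rewrite /eigenvalue /eigenspace kermx_eq0 row_free_unit.
  by rewrite -(@unitmxZ _ _ (-1)) ?unitrN1// scaleN1r opprB.
pose B := invmx S; pose K := entry_sum B + 1.
have ES0 : 0 <= entry_sum B by apply: sumr_ge0 => i _; apply: sumr_ge0.
have K1 : 1 <= K by rewrite lerDr.
have K0 : 0 < K by lra.
have step w : unit_sphere w -> qform A w <= m - K^-1.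
  move=> sw.
  have b1 : bil S w (B *m w) = 1.
    by rewrite /bil -mulmxA mulKVmx// -[RHS](expr1n _ 2) -sw -qform1 /qform mulmx1.
  have c1 : qform S (B *m w) <= K.
    rewrite /qform -mulmxA mulKVmx// trmx_mul trmx_inv ST -/B.
    have := qform_entry_sum B sw; rewrite /qform /K => h.
    by apply: (le_trans (ler_norm _)); lra.
  have := S0 (w + (- K^-1) *: (B *m w)).
  rewrite qformD// b1 qS sw expr1n mulr1 sqrrN => h.
  have : K^-1 ^+ 2 * qform S (B *m w) <= K^-1.
    by rewrite -[leRHS]mulr1 expr2 -mulrA ler_wpM2l ?invr_ge0 ?(ltW K0)// ler_pdivrMl// mulr1.
  lra.
have : m <= m - K^-1.
  by apply: ge_sup => // _ [w sw <-]; exact: step.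
have : 0 < K^-1 by rewrite invr_gt0.
lra.
Qed.

End linalg.

(** * Nets of the sphere *)

Section net.
Context {R : realType}.

Lemma geometric_sum_le (q : R) N : 0 <= q < 1 -> \sum_(i < N) q ^+ i <= (1 - q)^-1.
Proof.
move=> /andP[q0 q1]; have q1' : 0 < 1 - q by rewrite subr_gt0.
rewrite -[leRHS]mul1r ler_pdivlMr// mulrC.
have -> : (1 - q) * (\sum_(i < N) q ^+ i) = 1 - q ^+ N.
  by rewrite -opprB mulNr -subrX1 opprB.
by rewrite gerBl exprn_ge0.
Qed.

(** Integer points of the l1-ball of radius [p m], written as signs and absolute
   values.  Each of them has weight at least [q ^ (p m)] for the weight
   [\prod_i q ^ |z_i|], whose total mass is a product of geometric series;
   [q = m / (m + 1)] balances the two. *)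
Lemma card_lattice_ball (p m : nat) : (0 < m)%N ->
  (#|[set z : {ffun 'I_p -> bool * 'I_(p * m).+1} |
       (\sum_i (z i).2 <= p * m)%N]%SET|%:R : R) <= (2 * expR 1 * m.+1%:R) ^+ p.
Proof.
move=> m0; set S := finset _.
have m0' : 0 < m%:R :> R by rewrite ltr0n.
have m1' : 0 < m.+1%:R :> R by rewrite ltr0n.
have mS : m.+1%:R = m%:R + 1 :> R by rewrite -natr1.
pose q : R := m%:R / m.+1%:R.
have q0 : 0 < q by rewrite divr_gt0.
have q1 : q < 1 by rewrite ltr_pdivrMr// mul1r mS ltrDl.
have q1' : 1 - q = m.+1%:R^-1.
  by rewrite /q mS; field; rewrite -mS gt_eqF.
have qm : q ^- m <= expR 1.
  have : q^-1 <= expR (m%:R^-1).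
    apply: le_trans (expR_ge1Dx _); rewrite /q invf_div mS mulrDl divff ?gt_eqF//.
    by rewrite mul1r.
  move=> h; rewrite -exprVn; apply: (@le_trans _ _ (expR m%:R^-1 ^+ m)).
    by rewrite lerXn2r ?nnegrE ?expR_ge0// invr_ge0 ltW.
  by rewrite -expRM_natl mulfV ?gt_eqF.
pose F (z : {ffun 'I_p -> bool * 'I_(p * m).+1}) : R := \prod_(i < p) q ^+ (z i).2.
apply: (@le_trans _ R (q ^- (p * m) * \sum_(z : {ffun 'I_p -> bool * 'I_(p * m).+1}) F z)).
  rewrite -sum1_card natr_sum mulr_sumr big_mkcond /=; apply: ler_sum => z _.
  have Fz : F z = q ^+ (\sum_i (z i).2)%N by rewrite /F prodrXr.
  have Fz0 : 0 <= q ^- (p * m) * F z.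
    by rewrite mulr_ge0 ?invr_ge0 ?Fz ?exprn_ge0 // ltW.
  case: ifPn => // zS; rewrite mulr1n mulrC ler_pdivlMr ?exprn_gt0// mul1r Fz.
  by rewrite ler_wiXn2l ?(ltW q0) ?(ltW q1)//; move: zS; rewrite inE.
have -> : q ^- (p * m) = (q ^- m) ^+ p by rewrite mulnC exprM exprVn.
have G0 (x : bool * 'I_(p * m).+1) : 0 <= q ^+ x.2 by rewrite exprn_ge0// ltW.
rewrite /F -(bigA_distr_bigA (fun _ (x : bool * 'I_(p * m).+1) => q ^+ x.2)) /=.
rewrite prodr_const card_ord -exprMn lerXn2r ?nnegrE//.
- by rewrite mulr_ge0 ?invr_ge0 ?exprn_ge0 ?(ltW q0)// sumr_ge0.
rewrite [2 * _]mulrC -mulrA ler_pM//.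
- by rewrite invr_ge0 exprn_ge0 ?(ltW q0).
- by rewrite sumr_ge0.
rewrite -(pair_bigA _ (fun (b : bool) (i : 'I_(p * m).+1) => q ^+ i)) /=.
have := @geometric_sum_le q (p * m).+1; rewrite (ltW q0) q1 q1' invrK => /(_ isT) h.
by rewrite big_bool /=; lra.
Qed.

(** Coordinates are rounded towards 0 to multiples of [1 / (m sqrt p)], so that
   the l1-norm does not increase; it is at most [sqrt p] on the sphere. *)
Lemma lattice_approx (p m : nat) (v : 'cV[R]_p) : (0 < p)%N -> (0 < m)%N -> enorm v = 1 ->
  exists z : {ffun 'I_p -> bool * 'I_(p * m).+1},
    (\sum_i (z i).2 <= p * m)%N /\
    enorm (v - \col_i ((-1) ^+ (z i).1 * (z i).2%:R / (Num.sqrt p%:R * m%:R))) ^+ 2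
      <= (m%:R^-1) ^+ 2.
Proof.
move=> p0 m0 v1.
have p0' : 0 < p%:R :> R by rewrite ltr0n.
have m0' : 0 < m%:R :> R by rewrite ltr0n.
have s0 : 0 < Num.sqrt p%:R :> R by rewrite sqrtr_gt0.
have s2 : Num.sqrt p%:R ^+ 2 = p%:R :> R by rewrite sqr_sqrtr// ltW.
pose r : R := Num.sqrt p%:R * m%:R.
have r0 : 0 < r by rewrite mulr_gt0.
pose t i := Num.trunc (r * `|v i 0|).
have tle i : (t i)%:R <= r * `|v i 0| by rewrite truncn_le// mulr_ge0// ltW.
have tlt i : r * `|v i 0| < (t i)%:R + 1 by rewrite natr1 truncnS_gt.
have sum_le : (\sum_i t i <= p * m)%N.
  rewrite -(ler_nat R) natr_sum natrM.
  apply: (@le_trans _ _ (\sum_i r * `|v i 0|)); first exact: ler_sum.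
  rewrite -mulr_sumr.
  (* AM-GM in each coordinate, instead of the Cauchy-Schwarz inequality *)
  have : \sum_i Num.sqrt p%:R * `|v i 0| <= \sum_i (2^-1 * (1 + p%:R * v i 0 ^+ 2)).
    apply: ler_sum => i _.
    have -> : p%:R * v i 0 ^+ 2 = (Num.sqrt p%:R * `|v i 0|) ^+ 2.
      by rewrite exprMn s2 real_normK ?num_real.
    have := sqr_ge0 (Num.sqrt p%:R * `|v i 0| - 1); lra.
  rewrite -!mulr_sumr big_split /= -mulr_sumr -enorm_sqr v1 expr1n mulr1.
  rewrite big_const_ord iter_addr_0 => h.
  rewrite /r mulrAC ler_wpM2r// ?(ltW m0')//; lra.
have t_lt i : (t i < (p * m).+1)%N.
  by rewrite ltnS; apply: leq_trans sum_le; rewrite (bigD1 i)//= leq_addr.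
exists [ffun i => (v i 0 < 0, Ordinal (t_lt i))]; split.
  by under eq_bigr do rewrite ffunE.
rewrite enorm_sqr.
have -> : (m%:R^-1) ^+ 2 = \sum_(i < p) (r^-1 ^+ 2) :> R.
  rewrite big_const_ord iter_addr_0 -[RHS]mulr_natr /r !exprVn exprMn s2; field.
  by rewrite !gt_eqF.
apply: ler_sum => i _; rewrite !mxE ffunE /= -/r.
rewrite -[leLHS]real_normK ?num_real// lerXn2r ?nnegrE ?invr_ge0 ?(ltW r0)//.
have -> : v i 0 - (-1) ^+ (v i 0 < 0)%R * (t i)%:R / r =
   (-1) ^+ (v i 0 < 0)%R * (`|v i 0| - (t i)%:R / r).
  by rewrite mulrBr -realEsign ?num_real// mulrA.
rewrite normrM normr_sign mul1r ger0_norm; last first.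
  by rewrite subr_ge0 ler_pdivrMr// mulrC.
have := tlt i; rewrite -ltr_pdivlMl// mulrDr mulr1 mulrC => h; lra.
Qed.

(** The net is not contained in the sphere: its points have norm close to 1,
   which is all that the chaining requires. *)
Lemma sphere_net (p k : nat) : (0 < p)%N ->
  exists s : seq 'cV[R]_p,
    (size s)%:R <= expR (7 * k.+1%:R * p%:R) :> R /\
    forall v, enorm v = 1 ->
      exists2 w, w \in s & enorm (v - w) ^+ 2 <= 4^-1 * 64 ^- k.
Proof.
move=> p0; pose m := (2 * 8 ^ k)%N.
have m0 : (0 < m)%N by rewrite muln_gt0 expn_gt0.
pose S := [set z : {ffun 'I_p -> bool * 'I_(p * m).+1} | (\sum_i (z i).2 <= p * m)%N]%SET.
pose f (z : {ffun 'I_p -> bool * 'I_(p * m).+1}) : 'cV[R]_p :=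
  \col_i ((-1) ^+ (z i).1 * (z i).2%:R / (Num.sqrt p%:R * m%:R)).
exists [seq f z | z <- enum S]; split.
  rewrite size_map -cardE; apply: (le_trans (card_lattice_ball p m0)).
  have -> : expR (7 * k.+1%:R * p%:R) = expR (7 * k.+1%:R) ^+ p :> R.
    by rewrite -expRM_natl; congr expR; rewrite [RHS]mulrC.
  rewrite lerXn2r ?nnegrE ?expR_ge0//.
  have -> : m.+1%:R = 2 * 8 ^+ k + 1 :> R by rewrite -natr1 /m natrM natrX.
  have e1 : 2 <= expR 1 :> R by apply: le_trans (expR_ge1Dx 1); lra.
  have e5 : 6 <= expR 6 :> R by apply: le_trans (expR_ge1Dx _); lra.
  have e7 : 8 ^+ k <= expR (7 * k%:R) :> R.
    rewrite [7 * _]mulrC expRM_natl lerXn2r ?nnegrE ?expR_ge0//.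
    by apply: le_trans (expR_ge1Dx _); lra.
  have h1 : 1 <= 8 ^+ k :> R by rewrite exprn_ege1// ler1n.
  have -> : 7 * k.+1%:R = 1 + 6 + 7 * k%:R :> R by rewrite -(natr1 k); ring.
  rewrite (expRD (1 + 6)) (expRD 1 6).
  apply: (@le_trans _ _ (expR 1 * 6 * 8 ^+ k)).
    have := expR_gt0 (1 : R); set e := expR 1; set x := 8 ^+ k in h1 * => e0; nra.
  by apply: ler_pM => //; rewrite ler_wpM2l ?expR_ge0.
move=> v v1; have [z [zS zv]] := lattice_approx p0 m0 v1.
exists (f z); first by apply/map_f; rewrite mem_enum inE.
have E : 64 ^+ k = (8 ^+ k) ^+ 2 :> R.
  by rewrite -exprM mulnC exprM; congr (_ ^+ _); ring.
apply: (le_trans zv); rewrite /m natrM natrX E le_eqVlt; apply/orP; left; apply/eqP.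
by field; rewrite expf_neq0// pnatr_eq0.
Qed.

End net.

(** * Bernstein's inequality for differences of events *)

Section exp_bounds.
Context {R : realType}.

(** From [1 - z <= exp (- z)] at [z = y / 2], squared. *)
Lemma expR_le_quad (y : R) : `|y| <= 1 -> expR y <= 1 + y + 2 * y ^+ 2.
Proof.
rewrite ler_norml => /andP[y1 y2].
have half : expR (y / 2) <= 1 + y / 2 + y ^+ 2 / 2.
  have h0 : 0 < 1 - y / 2 by lra.
  have := expR_ge1Dx (- (y / 2)); rewrite expRN => h.
  have : expR (y / 2) <= (1 - y / 2)^-1.
    by rewrite -[leLHS]invrK lef_pV2 ?posrE ?invr_gt0 ?expR_gt0.
  move=> /le_trans; apply; rewrite -[leLHS]mul1r ler_pdivrMr//.
  have : 0 <= y ^+ 2 * (1 - y) by rewrite mulr_ge0 ?sqr_ge0//; lra.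
  lra.
have -> : expR y = expR (y / 2) ^+ 2.
  by rewrite expr2 -expRD; congr expR; field.
have h0 : 0 <= 1 + y / 2 + y ^+ 2 / 2 by have := sqr_ge0 y; lra.
apply: (@le_trans _ _ ((1 + y / 2 + y ^+ 2 / 2) ^+ 2)).
  by rewrite lerXn2r ?nnegrE ?expR_ge0.
have h1 : 0 <= y ^+ 2 * (1 - y) by rewrite mulr_ge0 ?sqr_ge0//; lra.
have h2 : 0 <= y ^+ 2 * (1 - y ^+ 2).
  by rewrite mulr_ge0 ?sqr_ge0// subr_ge0 expr2; nra.
have -> : (1 + y / 2 + y ^+ 2 / 2) ^+ 2 =
   1 + y + 5 / 4 * y ^+ 2 + y ^+ 2 * y / 2 + y ^+ 2 * y ^+ 2 / 4 by field.
have := sqr_ge0 y; lra.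
Qed.

(** Convexity of the exponential, obtained from its tangent at [f a]. *)
Lemma expR_weight (f a : R) : 0 <= f <= 1 -> expR (f * a) <= (1 - f) + f * expR a.
Proof.
move=> /andP[f0 f1].
have E0 := expR_gt0 (f * a).
have e1 : expR a = expR (f * a) * expR ((1 - f) * a) by rewrite -expRD; congr expR; ring.
have e2 : 1 = expR (f * a) * expR (- (f * a)) by rewrite expRN divff// gt_eqF.
have h1 : expR (f * a) * (1 + (1 - f) * a) <= expR a.
  by rewrite [leRHS]e1 ler_wpM2l ?expR_ge0// expR_ge1Dx.
have h2 : expR (f * a) * (1 - f * a) <= 1.
  by rewrite [leRHS]e2 ler_wpM2l ?expR_ge0// expR_ge1Dx.
have h3 : f * (expR (f * a) * (1 + (1 - f) * a)) <= f * expR a by rewrite ler_wpM2l.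
have h4 : (1 - f) * (expR (f * a) * (1 - f * a)) <= (1 - f) * 1 by rewrite ler_wpM2l ?subr_ge0.
lra.
Qed.

End exp_bounds.

Section bernstein.
Context {R : realType} {d d' : measure_display} {Omega : measurableType d}.
Context {T : measurableType d'} {Pr : probability Omega R}.
Context {n : nat} {P P0 : probability T R} {X : 'I_n -> {RV Pr >-> T}}.
Hypothesis iidX : iid_sample P X.
Variables (c0 : R) (f : T -> R).
Hypothesis c0_itv : 0 <= c0 <= 1.
Hypothesis mf : measurable_fun setT f.
Hypothesis f_itv : forall x, 0 <= f x <= 1.
Hypothesis f_int : forall h : T -> \bar R, measurable_fun setT h -> (forall x, 0 <= h x)%E ->
  (\int[P]_x ((f x)%:E * h x) = c0%:E * \int[P0]_x h x)%E.

Let pr B := fine (P0 B).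

Let prE B : measurable B -> P0 B = (pr B)%:E.
Proof. by move=> mB; rewrite fineK// fin_num_measure. Qed.

Let pr_ge0 B : 0 <= pr B. Proof. by rewrite fine_ge0. Qed.

Let int_f_indic B : measurable B -> (\int[P]_x (f x * \1_B x)%:E = (c0 * pr B)%:E)%E.
Proof.
move=> mB; rewrite EFinM -prE// -[X in P0 X]setIT -integral_indic// -f_int//.
  by apply/measurable_EFinP.
Qed.

Let pr_split B C : measurable B -> measurable C -> pr B = pr (B `\` C) + pr (B `&` C).
Proof.
move=> mB mC; apply: EFin_inj.
rewrite EFinD -!prE//; [exact: measureDI|exact: measurableI|exact: measurableD].
Qed.

Let pr_diff B C : measurable B -> measurable C ->
  pr B - pr C = pr (B `\` C) - pr (C `\` B).
Proof.
by move=> mB mC; rewrite (pr_split mB mC) (pr_split mC mB) (setIC C B); ring.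
Qed.

Let indic_diff (B C : set T) x : (\1_B x : R) - \1_C x = \1_(B `\` C) x - \1_(C `\` B) x.
Proof. by rewrite !indicE !in_setD; case: (x \in B); case: (x \in C); rewrite /=; ring. Qed.

Let intD (u v : T -> R) : measurable_fun setT u -> measurable_fun setT v ->
  (forall y, 0 <= u y) -> (forall y, 0 <= v y) ->
  (\int[P]_y (u y + v y)%:E = \int[P]_y (u y)%:E + \int[P]_y (v y)%:E)%E.
Proof.
move=> mu mv u0 v0; under eq_integral do rewrite EFinD.
by rewrite ge0_integralD//; try (by move=> y _; rewrite lee_fin); exact/measurable_EFinP.
Qed.

(** The weighted count of [B] minus that of [C] only sees the symmetric
   difference, of [P0]-mass at most [q], and so has variance at most [q].  The
   signed integrals are avoided by moving the negative part of the pointwise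
   quadratic bound to the left-hand side. *)
Lemma bernstein (B C : set T) (q l x : R) : measurable B -> measurable C ->
  fine (P0 (B `\` C)) + fine (P0 (C `\` B)) <= q -> 0 < l <= 1 ->
  whp Pr (expR (- (n%:R * (l * x - 2 * l ^+ 2 * q))))
    [set w | n%:R * (c0 * (fine (P0 B) - fine (P0 C)) - x) <=
             \sum_(i < n) f (X i w) * (\1_B (X i w) - \1_C (X i w))].
Proof.
move=> mB mC; rewrite -/(pr _) -/(pr (C `\` B)) -/(pr B) -/(pr C) => hq /andP[l0 l1].
have [c00 c01] := andP c0_itv.
pose h y := l * (c0 * (pr B - pr C) - x - f y * (\1_B y - \1_C y)).
have mBC : measurable (B `\` C) by exact: measurableD.
have mCB : measurable (C `\` B) by exact: measurableD.
have mh : measurable_fun setT h.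
  apply: measurable_funM => //; apply: measurable_funB => //.
  by apply: measurable_funM => //; apply: measurable_funB.
have key := chernoff iidX (h := h) (b := l * x - 2 * l ^+ 2 * q) mh.
apply: whp_sub (key _) => //.
  move=> w /=.
  have -> : \sum_(i < n) h (X i w) = l * (n%:R * (c0 * (pr B - pr C) - x) -
      \sum_(i < n) f (X i w) * (\1_B (X i w) - \1_C (X i w))).
    rewrite /h -mulr_sumr; congr (_ * _).
    by rewrite sumrB sumr_const card_ord mulr_natl.
  by rewrite pmulr_rle0// subr_le0.
set b := pr (B `\` C) in hq; set c := pr (C `\` B) in hq.
have b0 : 0 <= b := pr_ge0 _.
have c0' : 0 <= c := pr_ge0 _.
pose g y := expR (- (l * (f y * (\1_B y - \1_C y)))).
have g_pt y : g y + l * (f y * \1_(B `\` C) y) <=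
    1 + (l + 2 * l ^+ 2) * (f y * \1_(C `\` B) y) + 2 * l ^+ 2 * (f y * \1_(B `\` C) y).
  rewrite /g indic_diff; have /andP[f0 f1] := f_itv y.
  have lf : `|l * f y| <= 1.
    by rewrite ger0_norm ?mulr_ge0 ?(ltW l0)// -[leRHS]mulr1 ler_pM// ltW.
  have l2 : 2 * (l * f y) ^+ 2 <= 2 * l ^+ 2 * f y.
    have : l ^+ 2 * (f y * f y) <= l ^+ 2 * (f y * 1).
      by rewrite ler_wpM2l ?sqr_ge0// ler_wpM2l.
    lra.
  rewrite !indicE !in_setD.
  have e1 := @expR_le_quad R (- (l * f y)); have e2 := @expR_le_quad R (l * f y).
  rewrite normrN in e1; have {}e1 := e1 lf; have {}e2 := e2 lf; rewrite sqrrN in e1.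
  case: (y \in B); case: (y \in C) => /=;
    rewrite ?mulr0 ?mulr1 ?subr0 ?sub0r ?subrr ?mulr0 ?addr0 ?oppr0 ?expR0 ?mulrN ?opprK ?mulr1//; lra.
have mg : measurable_fun setT g.
  apply: measurableT_comp => //; apply: measurableT_comp => //; apply: measurable_funM => //.
  by apply: measurable_funM => //; apply: measurable_funB.
have mf1 D : measurable D -> measurable_fun setT (fun y => f y * \1_D y).
  by move=> mD; apply: measurable_funM.
have fD0 D y : 0 <= f y * \1_D y.
  by rewrite mulr_ge0//; have /andP[] := f_itv y.
have intg : (\int[P]_y (g y)%:E + (l * (c0 * b))%:E <=
    (1 + (l + 2 * l ^+ 2) * (c0 * c) + 2 * l ^+ 2 * (c0 * b))%:E)%E.
  have I1 (k : R) D : 0 <= k -> measurable D ->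
      (\int[P]_y (k * (f y * \1_D y))%:E = (k * (c0 * pr D))%:E)%E.
    move=> k0 mD; under eq_integral do rewrite EFinM.
    rewrite ge0_integralZl_EFin//; last 2 first.
    - by move=> y _; rewrite lee_fin.
    - by apply/measurable_EFinP; exact: mf1.
    by rewrite int_f_indic.
  have l20 : 0 <= 2 * l ^+ 2 by rewrite mulr_ge0 ?sqr_ge0.
  have l21 : 0 <= l + 2 * l ^+ 2 by lra.
  have J1 : (\int[P]_y (g y + l * (f y * \1_(B `\` C) y))%:E =
             \int[P]_y (g y)%:E + (l * (c0 * b))%:E)%E.
    rewrite intD ?I1 ?ltW//.
    - by apply: measurable_funM => //; exact: mf1.
    - by move=> y; exact: expR_ge0.
    - by move=> y; rewrite mulr_ge0// ltW.
  have J2 : (\int[P]_y (1 + (l + 2 * l ^+ 2) * (f y * \1_(C `\` B) y) +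
                        2 * l ^+ 2 * (f y * \1_(B `\` C) y))%:E =
             (1 + (l + 2 * l ^+ 2) * (c0 * c) + 2 * l ^+ 2 * (c0 * b))%:E)%E.
    have mk k D : measurable D -> measurable_fun setT (fun y => k * (f y * \1_D y)).
      by move=> mD; apply: measurable_funM => //; exact: mf1.
    have k0 k D y : 0 <= k -> 0 <= k * (f y * \1_D y) by move=> ?; rewrite mulr_ge0.
    have m1 := measurable_funD (@measurable_cst _ _ T R setT 1)
                 (mk (l + 2 * l ^+ 2) _ mCB).
    have P1 : (\int[P]_y 1%:E = 1%:E)%E.
      by rewrite integral_cst// mul1e; exact: probability_setT.
    rewrite intD//; [|exact: mk|by move=> y; rewrite addr_ge0// k0|by move=> y; exact: k0].
    rewrite intD//; [|exact: mk|by move=> y; exact: k0].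
    by rewrite P1 !I1.
  rewrite -J1 -J2; apply: ge0_le_integral => //.
  - by move=> y _; rewrite lee_fin addr_ge0 ?expR_ge0// mulr_ge0// ltW.
  - apply/measurable_EFinP; apply: measurable_funD => //.
    by apply: measurable_funM => //; exact: mf1.
  - apply/measurable_EFinP; apply: measurable_funD; last first.
      by apply: measurable_funM => //; exact: mf1.
    apply: measurable_funD => //.
    by apply: measurable_funM => //; exact: mf1.
  - by move=> y _; rewrite lee_fin.
have intg' : (\int[P]_y (g y)%:E <= (expR (- (l * (c0 * (b - c))) + 2 * l ^+ 2 * q))%:E)%E.
  apply: (@le_trans _ _ (1 - l * (c0 * (b - c)) + 2 * l ^+ 2 * q)%:E); last first.
    by rewrite lee_fin -addrA; exact: expR_ge1Dx.
  move: intg; set I := (\int[P]_y _)%E => intg.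
  have Ifin : I \is a fin_num.
    rewrite ge0_fin_numE; last by apply: integral_ge0 => y _; rewrite lee_fin expR_ge0.
    apply: le_lt_trans (ltry (1 + (l + 2 * l ^+ 2) * (c0 * c) + 2 * l ^+ 2 * (c0 * b))).
    apply: le_trans intg; rewrite leeDl// lee_fin mulr_ge0 ?mulr_ge0//; exact: ltW.
  move: intg; rewrite -(fineK Ifin) -EFinD !lee_fin => intg.
  have : 2 * l ^+ 2 * (c0 * (b + c)) <= 2 * l ^+ 2 * q.
    have cq : c0 * (b + c) <= q.
      by apply: le_trans hq; rewrite -[leRHS]mul1r ler_wpM2r// addr_ge0.
    have l20 : 0 <= 2 * l ^+ 2 by rewrite mulr_ge0 ?sqr_ge0.
    exact: ler_wpM2l.
  lra.
have -> : (\int[P]_y (expR (h y))%:E =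
           (expR (l * (c0 * (b - c) - x)))%:E * \int[P]_y (g y)%:E)%E.
  have g0 y : setT y -> (0 <= (g y)%:E)%E by rewrite lee_fin expR_ge0.
  have mg' : measurable_fun setT (fun y => (g y)%:E) by exact/measurable_EFinP.
  rewrite -ge0_integralZl_EFin ?expR_ge0//.
  apply: eq_integral => y _; rewrite -EFinM -expRD /h /b /c -pr_diff//.
  by congr (expR _)%:E; ring.
apply: (le_trans (lee_wpmul2l _ intg')); first by rewrite lee_fin expR_ge0.
rewrite -EFinM lee_fin -expRD ler_expR; lra.
Qed.

End bernstein.

(** * The weighted empirical covariance *)

Section covariance.
Context {R : realType} {d : measure_display} {Omega : measurableType d}.
Context {p n : nat} {Pr : probability Omega R}.
Context {P P0 : probability (p.-tuple R) R} {X : 'I_n -> {RV Pr >-> p.-tuple R}}.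
Hypothesis iidX : iid_sample P X.
Variables (c0 : R) (f : p.-tuple R -> R) (A : 'M[R]_p).
Hypothesis c0_itv : 0 <= c0 <= 1.
Hypothesis mf : measurable_fun setT f.
Hypothesis f_itv : forall x, 0 <= f x <= 1.
Hypothesis f_int : forall h : p.-tuple R -> \bar R,
  measurable_fun [set: p.-tuple R] h -> (forall x, 0 <= h x)%E ->
  (\int[P]_x ((f x)%:E * h x) = c0%:E * \int[P0]_x h x)%E.
Notation N := (normal_prob (0 : R) 1).
Notation l := (fun (v : 'cV[R]_p) (x : p.-tuple R) => dotp (A *m v) x).
Hypothesis law : forall v (B : set R), measurable B ->
  P0 [set x | B (l v x)] = N [set z | B (enorm v * z)].

Lemma integral_law v (g : R -> R) : measurable_fun setT g -> (forall x, 0 <= g x) ->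
  (\int[P0]_x (g (l v x))%:E = \int[N]_z (g (enorm v * (z : R)))%:E)%E.
Proof.
move=> mg g0.
have ml : measurable_fun [set: p.-tuple R] (l v) by exact: measurable_dotp.
have ms : measurable_fun [set: R] (fun z : R => enorm v * z) by exact: measurable_funM.
pose L : {mfun p.-tuple R >-> R} := HB.pack (l v) (isMeasurableFun.Build _ _ _ _ _ ml).
pose S : {mfun R >-> R} := HB.pack (fun z : R => enorm v * z)
  (isMeasurableFun.Build _ _ _ _ _ ms).
have mg' : measurable_fun setT (fun y => (g y)%:E) by exact/measurable_EFinP.
have g0' y : (0 <= (g y)%:E)%E by rewrite lee_fin.
rewrite -[RHS]integral_stdgauss//; last exact: (measurableT_comp mg' ms).
rewrite -[LHS](ge0_integral_distribution L mg')//.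
rewrite -[RHS](ge0_integral_distribution S mg')//.
by apply: eq_measure_integral => B mB _; exact: law.
Qed.

(** Chernoff's inequality; the condition on [v] makes [|v|^2 / 16 <= 1 / 4], the
   exponential moment controlled by [normal_exp_moment]. *)
Lemma covariance_point v : enorm v ^+ 2 <= 5 / 2 ->
  whp Pr (expR (- n%:R)) [set w | \sum_(i < n) f (X i w) * l v (X i w) ^+ 2 <= 48 * n%:R].
Proof.
move=> v52.
have ml : measurable_fun [set: p.-tuple R] (l v) by exact: measurable_dotp.
pose h x := f x * (l v x ^+ 2 / 16) - 3.
have mh : measurable_fun [set: p.-tuple R] h.
  apply: measurable_funB => //; apply: measurable_funM => //.
  by apply: measurable_funM => //; exact: measurable_funX.
have key := chernoff iidX (h := h) (b := 1) mh.
have -> : - n%:R = - (n%:R * 1) :> R by rewrite mulr1.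
apply: whp_sub (key _) => //.
  move=> w /=; rewrite /h sumrB sumr_const card_ord -[3 *+ n]mulr_natr.
  have -> : \sum_(i < n) f (X i w) * (l v (X i w) ^+ 2 / 16) =
            16^-1 * \sum_(i < n) f (X i w) * l v (X i w) ^+ 2.
    by rewrite mulr_sumr; apply: eq_bigr => i _; ring.
  lra.
have mexp : measurable_fun [set: p.-tuple R] (fun x => (expR (l v x ^+ 2 / 16))%:E).
  apply/measurable_EFinP; apply: measurableT_comp => //.
  by apply: measurable_funM => //; exact: measurable_funX.
have expm : (\int[P0]_x (expR (l v x ^+ 2 / 16))%:E <= 2%:E)%E.
  rewrite (@integral_law v (fun t => expR (t ^+ 2 / 16))); last 2 first.
  - apply: measurableT_comp => //.
    by apply: measurable_funM => //; exact: measurable_funX.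
  - by move=> t; exact: expR_ge0.
  apply: le_trans normal_exp_moment; apply: ge0_le_integral => //.
  - apply/measurable_EFinP; apply: measurableT_comp => //.
    by apply: measurable_funM => //; apply: measurable_funX; exact: measurable_funM.
  - apply/measurable_EFinP; apply: measurableT_comp => //.
    by apply: measurable_funM => //; exact: measurable_funX.
  - move=> z _; rewrite lee_fin ler_expR exprMn.
    have : enorm v ^+ 2 * (z : R) ^+ 2 <= 4 * (z : R) ^+ 2.
      by rewrite ler_wpM2r ?sqr_ge0//; lra.
    lra.
have fexp : (\int[P]_x (f x * expR (l v x ^+ 2 / 16))%:E <= 2%:E)%E.
  under eq_integral do rewrite EFinM.
  rewrite f_int//.
  apply: (@le_trans _ _ (1%:E * 2%:E)%E); last by rewrite mul1e.
  have /andP[c00 c01] := c0_itv.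
  apply: lee_pmul => //; rewrite ?lee_fin//.
  by apply: integral_ge0 => x _; rewrite lee_fin expR_ge0.
apply: (@le_trans _ _ ((expR (-3))%:E *
    \int[P]_x (1 + f x * expR (l v x ^+ 2 / 16))%:E)%E).
  have m1 : measurable_fun [set: p.-tuple R] (fun x => (1 + f x * expR (l v x ^+ 2 / 16))%:E).
    apply/measurable_EFinP; apply: measurable_funD => //; apply: measurable_funM => //.
    exact/measurable_EFinP.
  have p1 x : (0 <= (1 + f x * expR (l v x ^+ 2 / 16))%:E)%E.
    by have /andP[f0 _] := f_itv x; rewrite lee_fin addr_ge0// mulr_ge0// expR_ge0.
  rewrite -ge0_integralZl_EFin ?expR_ge0//.
  apply: ge0_le_integral => //.
  - by apply/measurable_EFinP; apply: measurableT_comp.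
  - exact: measurable_funeM.
  - move=> x _; rewrite -EFinM lee_fin /h expRD mulrC ler_wpM2l ?expR_ge0//.
    have /andP[f0 f1] := f_itv x.
    by apply: (le_trans (expR_weight _ (f_itv x))); lra.
have -> : (\int[P]_x (1 + f x * expR (l v x ^+ 2 / 16))%:E =
           1%:E + \int[P]_x (f x * expR (l v x ^+ 2 / 16))%:E)%E.
  have m2 : measurable_fun [set: p.-tuple R] (fun x => (f x * expR (l v x ^+ 2 / 16))%:E).
    apply/measurable_EFinP; apply: measurable_funM => //; exact/measurable_EFinP.
  have p2 x : [set: p.-tuple R] x -> (0 <= (f x * expR (l v x ^+ 2 / 16))%:E)%E.
    by move=> _; have /andP[f0 _] := f_itv x; rewrite lee_fin mulr_ge0// expR_ge0.
  under eq_integral do rewrite EFinD.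
  rewrite ge0_integralD//; congr (_ + _)%E.
  by rewrite integral_cst// mul1e; exact: probability_setT.
apply: (@le_trans _ _ ((expR (-3))%:E * (1%:E + 2%:E))%E).
  by rewrite lee_wpmul2l ?lee_fin ?expR_ge0// leeD2l.
rewrite -EFinD -EFinM lee_fin.
have -> : expR (- 1) = expR (-3) * expR 2 :> R by rewrite -expRD; congr expR; ring.
by rewrite ler_wpM2l ?expR_ge0//; apply: le_trans (expR_ge1Dx 2).
Qed.

End covariance.

(** If [m] is the supremum of the form on the sphere, the parallelogram law
   between a point and its neighbour in the net gives [m <= 2 K + m / 2]. *)
Lemma qform_net_le {R : realType} {p : nat} (S : 'M[R]_p) (s : seq 'cV[R]_p) (K : R) :
  S^T = S -> (forall u, 0 <= qform S u) ->
  (forall v, enorm v = 1 -> exists2 w, w \in s & enorm (v - w) ^+ 2 <= 4^-1) ->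
  (forall w, w \in s -> enorm w ^+ 2 <= 5 / 2 -> qform S w <= K) ->
  forall v, qform S v <= 4 * K * enorm v ^+ 2.
Proof.
move=> ST S0 sN sK; apply: qform_le_sphere => u su.
pose E : set R := [set qform S w | w in unit_sphere].
have Eub : has_ubound E.
  by exists (entry_sum S) => _ [w sw <-]; apply: le_trans (qform_entry_sum S sw); exact: ler_norm.
have E0 : E !=set0 by exists (qform S u), u.
have um w : unit_sphere w -> qform S w <= sup E by move=> sw; apply: ub_le_sup => //; exists w.
have step w : unit_sphere w -> qform S w <= 2 * K + sup E / 2.
  move=> sw; have [z zs wz] := sN w sw.
  have z52 : enorm z ^+ 2 <= 5 / 2.
    have := enorm_sqr_le z w; rewrite sw expr1n enorm_subC; lra.
  have zK := sK z zs z52.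
  have q1 := qform_le_sphere um (w - z).
  have q2 := qformD z (w - z) 1 ST; have q3 := qformD z (w - z) (-1) ST.
  have q4 := S0 (z + (-1) *: (w - z)).
  rewrite scale1r addrC subrK in q2.
  have : sup E * enorm (w - z) ^+ 2 <= sup E / 4.
    rewrite ler_wpM2l//; apply: le_trans (um u su); exact: S0.
  lra.
have : sup E <= 2 * K + sup E / 2 by apply: ge_sup => // _ [w sw <-]; exact: step.
have := um u su; lra.
Qed.

(** * Chaining over the directions *)

Section chaining.
Context {R : realType} {d : measure_display} {Omega : measurableType d}.
Context {p n : nat} {Pr : probability Omega R}.
Context {P P0 : probability (p.-tuple R) R} {X : 'I_n -> {RV Pr >-> p.-tuple R}}.
Hypothesis p_gt0 : (0 < p)%N.
Hypothesis n_gt0 : (0 < n)%N.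
Hypothesis iidX : iid_sample P X.
Variables (c0 : R) (f : p.-tuple R -> R) (A : 'M[R]_p).
Hypothesis c0_itv : 0 <= c0 <= 1.
Hypothesis mf : measurable_fun setT f.
Hypothesis f_itv : forall x, 0 <= f x <= 1.
Hypothesis f_int : forall h : p.-tuple R -> \bar R,
  measurable_fun [set: p.-tuple R] h -> (forall x, 0 <= h x)%E ->
  (\int[P]_x ((f x)%:E * h x) = c0%:E * \int[P0]_x h x)%E.
Notation N := (normal_prob (0 : R) 1).
Notation l := (fun (v : 'cV[R]_p) (x : p.-tuple R) => dotp (A *m v) x).
Hypothesis law : forall v (B : set R), measurable B ->
  P0 [set x | B (l v x)] = N [set z | B (enorm v * z)].
Variables (H : set R) (t : R).
Hypothesis mH : measurable H.
(* [H] is one of the sets [|z| <= t], [|z| >= t], [|z| < t], [|z| > t]: leaving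
   [H] means crossing one of the levels [t] and [- t]. *)
Hypothesis H_cross : forall x y, H x -> ~ H y -> `| `|x| - t | <= `|x - y|.

Let pr B := fine (P0 B).

Let prE B : measurable B -> P0 B = (pr B)%:E.
Proof. by move=> mB; rewrite fineK// fin_num_measure. Qed.

Let pr_le B C : measurable B -> measurable C -> B `<=` C -> pr B <= pr C.
Proof.
by move=> mB mC BC; rewrite -lee_fin -!prE// le_measure// inE.
Qed.

Let pr_leU B C D : measurable B -> measurable C -> measurable D ->
  B `<=` C `|` D -> pr B <= pr C + pr D.
Proof.
move=> mB mC mD BCD; rewrite -lee_fin EFinD -!prE//.
apply: le_trans (measureU2 _ mC mD); apply: le_measure; rewrite ?inE//.
exact: measurableU.
Qed.

Let ml v : measurable_fun [set: p.-tuple R] (l v).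
Proof. exact: measurable_dotp. Qed.

Let m_pre v (B : set R) : measurable B -> measurable [set x | B (l v x)].
Proof. by move=> mB; rewrite -[X in measurable X]setTI; exact: ml. Qed.

Let lB v w x : l (v - w) x = l v x - l w x.
Proof. by rewrite /dotp mulmxBr linearB /= mulmxBl !mxE. Qed.

Let band (a : R) : set R := [set z | `| `|z| - t| <= a].
Let tail (a : R) : set R := [set z | a < `|z|].

Let m_band a : measurable (band a). Proof. exact: measurable_norm_band. Qed.
Let m_tail a : measurable (tail a). Proof. exact: measurable_norm_gt. Qed.

(* [S v] is the event of interest in direction [v], and [Sm v a] the part of it
   at distance more than [a] from the boundary. *)
Let Band v a := [set x | band a (l v x)].
Let Tail v a := [set x | tail a (l v x)].
Let S v := [set x | H (l v x)].
Let Sm v a := [set x | (H `\` band a) (l v x)].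

Let mBand v a : measurable (Band v a). Proof. exact: m_pre. Qed.
Let mTail v a : measurable (Tail v a). Proof. exact: m_pre. Qed.
Let mS v : measurable (S v). Proof. exact: m_pre. Qed.
Let mSm v a : measurable (Sm v a).
Proof. by apply: m_pre; exact: measurableD. Qed.

Let pr_Band v a : 4^-1 <= enorm v ^+ 2 -> 0 <= a -> pr (Band v a) <= 4 * a.
Proof.
move=> v4 a0; rewrite -lee_fin -prE// /Band law//; apply: normal_band_le => //.
rewrite -(@ler_pXn2r _ 2%N)// ?nnegrE ?enorm_ge0//.
by apply: le_trans v4; rewrite exprVn -natrX.
Qed.

Let pr_Tail v a : 0 < a -> pr (Tail v a) <= 8 * enorm v ^+ 2 / a ^+ 2.
Proof. by move=> a0; rewrite -lee_fin -prE// /Tail law//; exact: normal_tail_le. Qed.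

(** A point that separates the directions [u] and [v] is close to the boundary
   for [u], unless it has a large component along [u - v]. *)
Let S_diff u v a : S u `\` S v `<=` Band u a `|` Tail (u - v) a.
Proof.
move=> x [/= Hu nHv]; rewrite /Band /Tail /band /tail /=.
have [ua|au] := leP `| `|l u x| - t| a; [by left|right].
by rewrite lB; apply: lt_le_trans au _; exact: H_cross.
Qed.

Let pr_S_diff u v a : 4^-1 <= enorm u ^+ 2 -> 0 < a ->
  pr (S u `\` S v) <= 4 * a + 8 * enorm (u - v) ^+ 2 / a ^+ 2.
Proof.
move=> u4 a0.
apply: (le_trans (pr_leU (measurableD (mS u) (mS v)) (mBand u a) (mTail (u - v) a) (@S_diff u v a))).
by rewrite lerD// ?pr_Band// ?pr_Tail// ltW.
Qed.

Let Sf w (B : set (p.-tuple R)) := \sum_(i < n) f (X i w) * \1_B (X i w).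

Let ev x B C w := n%:R * (c0 * (pr B - pr C) - x) <= Sf w B - Sf w C.

Let whp_ev (B C : set (p.-tuple R)) (q la x eta : R) : measurable B -> measurable C ->
  pr (B `\` C) + pr (C `\` B) <= q -> 0 < la <= 1 ->
  expR (- (n%:R * (la * x - 2 * la ^+ 2 * q))) <= eta -> whp Pr eta (ev x B C).
Proof.
move=> mB mC hq la01 heta.
apply: whp_sub (bernstein iidX c0_itv mf f_itv f_int x mB mC hq la01) => // w /=.
rewrite /ev /Sf -sumrB => /le_trans; apply.
by apply: ler_sum => i _; rewrite mulrBr.
Qed.

(* The scale [y] of the last level is of the order of [sqrt (s / n)]. *)
Variables (delta : R) (K : nat).
Hypothesis delta01 : 0 < delta < 1.
Let s : R := p%:R + ln (1 / delta).
Let y : R := 2^-1 ^+ K.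
Hypothesis s_le : s <= n%:R * y ^+ 2.
Hypothesis s_le_n : 36 * s <= n%:R.

Let nR : 0 < n%:R :> R. Proof. by rewrite ltr0n. Qed.
Let pR : 1 <= p%:R :> R. Proof. by rewrite ler1n. Qed.
Let lnd : 0 <= ln (1 / delta).
Proof.
have /andP[d0 d1] := delta01.
by rewrite ln_ge0// mul1r invf_ge1// ltW.
Qed.
Let y_gt0 : 0 < y. Proof. by rewrite exprn_gt0// invr_gt0. Qed.
Let y_le1 : y <= 1. Proof. by apply: exprn_ile1; lra. Qed.

(** Deviations at level [k] are taken of probability [exp (- 36 (k + 1) s)], to
   beat the number of pairs of net points, at most [exp (21 (k + 1) p)], and to
   leave a summable failure probability. *)
Let exp_small (k : nat) :
  expR (21 * k.+1%:R * p%:R) * expR (- (36 * k.+1%:R * s)) <= delta * 16^-1 ^+ k.+1.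
Proof.
have /andP[d0 d1] := delta01.
have k1 : 1 <= k.+1%:R :> R by rewrite ler1n.
rewrite -expRD.
have h1 : 21 * k.+1%:R * p%:R - 36 * k.+1%:R * s <= - ln (1 / delta) + - (15 * k.+1%:R).
  have : 1 * ln (1 / delta) <= k.+1%:R * ln (1 / delta) by rewrite ler_wpM2r.
  have : k.+1%:R * 1 <= k.+1%:R * p%:R :> R by rewrite ler_wpM2l.
  have : 0 <= k.+1%:R * ln (1 / delta) by rewrite mulr_ge0.
  rewrite /s; lra.
apply: (@le_trans _ _ (expR (- ln (1 / delta) + - (15 * k.+1%:R)))).
  by rewrite ler_expR.
rewrite expRD expRN lnK ?posrE ?divr_gt0// div1r invrK ler_wpM2l ?(ltW d0)//.
rewrite mulrC expRN expRM_natl -exprVn lerXn2r ?nnegrE ?invr_ge0 ?expR_ge0//.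
rewrite lef_pV2 ?posrE ?expR_gt0//; apply: le_trans (expR_ge1Dx _); lra.
Qed.

Variable net : nat -> seq 'cV[R]_p.
Hypothesis net_size : forall k, (size (net k))%:R <= expR (7 * k.+1%:R * p%:R) :> R.
Hypothesis net_near : forall k v, enorm v = 1 ->
  exists2 w, w \in net k & enorm (v - w) ^+ 2 <= 4^-1 * 64 ^- k.

Let whp_net k (E : 'cV[R]_p -> set Omega) :
  (forall u, u \in net k -> whp Pr (expR (- (36 * k.+1%:R * s))) (E u)) ->
  whp Pr (delta * 16^-1 ^+ k.+1) [set w | forall u, u \in net k -> E u w].
Proof.
move=> Eu; apply: whp_sub (whp_seq Eu) => //.
rewrite big_const_seq count_predT iter_addr_0 -[leLHS]mulr_natl.
apply: le_trans (exp_small k); rewrite ler_wpM2r ?expR_ge0//.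
have h0 : 0 <= k.+1%:R * p%:R :> R by rewrite mulr_ge0.
by apply: (le_trans (net_size k)); rewrite ler_expR; lra.
Qed.

(* The four families of deviations: the coarsest net ([E0]), the increments
   between consecutive nets ([E1]), the passage from [S] to [Sm] on the finest
   net ([E2]) and the empirical covariance ([E3]). *)
Let E0 w := forall u, u \in net 0 -> 4^-1 <= enorm u ^+ 2 -> ev (38 * y) (S u) set0 w.

Let whp_E0 : whp Pr (delta / 16) E0.
Proof.
have -> : delta / 16 = delta * 16^-1 ^+ 1 by rewrite expr1.
apply: whp_sub (whp_net (k := 0) (E := fun u w =>
    4^-1 <= enorm u ^+ 2 -> ev (38 * y) (S u) set0 w) _) => //.
move=> u _; have [u4|u4] := boolP (4^-1 <= enorm u ^+ 2); last first.
  by apply: whp_sub (whpT _ (expR_ge0 (- (36 * 1%:R * s)))).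
apply: (@whp_sub _ _ _ _ (expR (- (36 * 1 * s))) _ (ev (38 * y) (S u) set0)) => //.
apply: (@whp_ev _ _ 1 y) => //.
- rewrite setD0 set0D [X in _ + X](_ : _ = 0) ?addr0; last by rewrite /pr measure0.
  by rewrite -lee_fin -prE// probability_le1.
- by rewrite y_gt0.
- by rewrite ler_expR lerN2; move: s_le; rewrite expr2; lra.
Qed.

(* Increments at level [k] have variance at most [24 / 4^k]; Bernstein's
   inequality is used with parameter [2^k y], which is at most 1 up to level
   [K]. *)
Let xk k := y * 2^-1 ^+ k * (48 + 36 * k.+1%:R).

Let E1 w := forall k, (k < K)%N -> forall u v, u \in net k.+1 -> v \in net k ->
  4^-1 <= enorm u ^+ 2 -> 4^-1 <= enorm v ^+ 2 -> enorm (u - v) ^+ 2 <= 64 ^- k ->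
  ev (xk k) (S u) (S v) w.

Let whp_E1k k : (k < K)%N ->
  whp Pr (delta * 16^-1 ^+ k.+1) [set w | forall u v, u \in net k.+1 -> v \in net k ->
  4^-1 <= enorm u ^+ 2 -> 4^-1 <= enorm v ^+ 2 -> enorm (u - v) ^+ 2 <= 64 ^- k ->
  ev (xk k) (S u) (S v) w].
Proof.
move=> kK.
pose good (uv : 'cV[R]_p * 'cV[R]_p) :=
  [&& 4^-1 <= enorm uv.1 ^+ 2, 4^-1 <= enorm uv.2 ^+ 2 & enorm (uv.1 - uv.2) ^+ 2 <= 64 ^- k].
pose E (uv : 'cV[R]_p * 'cV[R]_p) w := good uv -> ev (xk k) (S uv.1) (S uv.2) w.
pose pairs := [seq (u, v) | u <- net k.+1, v <- net k].
have Ep uv : uv \in pairs -> whp Pr (expR (- (36 * k.+1%:R * s))) (E uv).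
  move=> _; have [/and3P[u4 v4 uv64]|/negP nuv] := boolP (good uv); last first.
    by apply: whp_sub (whpT _ (expR_ge0 (- (36 * k.+1%:R * s)))) => // w _ /nuv.
  pose a : R := 4 ^- k.
  have a0 : 0 < a by rewrite invr_gt0 exprn_gt0.
  have h2 : 2^-1 ^+ k ^+ 2 = a :> R.
    by rewrite -exprM mulnC exprM /a -exprVn; congr (_ ^+ _); field.
  pose z : R := 2^-1 ^+ k.
  have z0 : 0 < z by rewrite exprn_gt0// invr_gt0.
  have z2 : z ^+ 2 = a by [].
  have h64 : 8 * 64 ^- k / a ^+ 2 = 8 * a :> R.
    have : 4 ^+ k != 0 :> R by rewrite expf_neq0// pnatr_eq0.
    have -> : 64 ^+ k = 4 ^+ k ^+ 3 :> R.
      by rewrite -exprM mulnC exprM; congr (_ ^+ _); ring.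
    by rewrite /a => h; field.
  apply: (@whp_sub _ _ _ _ (expR (- (36 * k.+1%:R * s))) _ (ev (xk k) (S uv.1) (S uv.2))) => //; first by move=> w ? _.
  apply: (@whp_ev _ _ (24 * a) (y / z)) => //.
  - have a2 : 0 < a ^+ 2 by rewrite exprn_gt0.
    have := pr_S_diff uv.2 u4 a0; have := pr_S_diff uv.1 v4 a0.
    have tl : 8 * enorm (uv.1 - uv.2) ^+ 2 / a ^+ 2 <= 8 * a.
      by rewrite -h64 ler_wpM2r ?invr_ge0 ?(ltW a2)// ler_wpM2l.
    rewrite (enorm_subC uv.2 uv.1); lra.
  - rewrite divr_gt0//= ler_pdivrMr// mul1r /y /z.
    by apply: ler_wiXn2l; [lra|lra|exact: ltnW].
  - rewrite ler_expR lerN2.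
    have -> : y / z * xk k - 2 * (y / z) ^+ 2 * (24 * a) = 36 * k.+1%:R * y ^+ 2.
      by rewrite /xk -/z -z2; field; rewrite gt_eqF.
    have : 36 * k.+1%:R * s <= 36 * k.+1%:R * (n%:R * y ^+ 2).
      by rewrite ler_wpM2l// mulr_ge0.
    lra.
have := whp_seq Ep; apply: whp_sub.
  rewrite big_const_seq count_predT iter_addr_0 -[leLHS]mulr_natl.
  apply: le_trans (exp_small k); rewrite ler_wpM2r ?expR_ge0//.
  rewrite size_allpairs natrM.
  have -> : 21 * k.+1%:R * p%:R = (7 * (k.+1%:R + k.+1%:R) * p%:R) + 7 * k.+1%:R * p%:R :> R by ring.
  rewrite expRD ler_pM//; apply: (le_trans (net_size k.+1)).
  rewrite ler_expR ler_wpM2r// ler_wpM2l// -natr1 lerD2l ler1n //.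
move=> w /= Ew u v uk vk u4 v4 uv64.
apply: (Ew (u, v)); first by apply/allpairsP; exists (u, v).
by rewrite /good /= u4 v4 uv64.
Qed.

Let whp_E1 : whp Pr (delta / 15) E1.
Proof.
have := @whp_seq _ _ _ Pr _ (iota 0 K) (fun k => delta * 16^-1 ^+ k.+1)
  (fun k w => forall u v, u \in net k.+1 -> v \in net k ->
  4^-1 <= enorm u ^+ 2 -> 4^-1 <= enorm v ^+ 2 -> enorm (u - v) ^+ 2 <= 64 ^- k ->
  ev (xk k) (S u) (S v) w).
move=> h; apply: whp_sub (h _) => //.
- have /andP[d0 _] := delta01.
  rewrite -mulr_sumr ler_wpM2l ?(ltW d0)//.
  have -> : iota 0 K = index_iota 0 K by rewrite /index_iota subn0.
  rewrite big_mkord.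
  under eq_bigr do rewrite exprS.
  rewrite -mulr_sumr; have := @geometric_sum_le R 16^-1 K.
  have -> : (1 - 16^-1)^-1 = 16 / 15 :> R by field.
  move=> /(_ ltac:(apply/andP; split; lra)); lra.
- by move=> w /= Ew k kK; apply: Ew; rewrite mem_iota.
- by move=> k; rewrite mem_iota add0n => kK; exact: whp_E1k.
Qed.

Let a : R := y ^+ 2.

Let a_gt0 : 0 < a. Proof. exact: exprn_gt0. Qed.

Let E2 w := forall u, u \in net K -> 4^-1 <= enorm u ^+ 2 ->
  ev (44 * y) (Sm u a) (S u) w.

Let whp_E2 : whp Pr (delta / 16) E2.
Proof.
have /andP[d0 d1] := delta01.
apply: whp_sub (whp_net (k := K) (E := fun u w =>
    4^-1 <= enorm u ^+ 2 -> ev (44 * y) (Sm u a) (S u) w) _) => //.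
  rewrite ler_wpM2l ?(ltW d0)// exprS -[leRHS]mulr1 ler_wpM2l ?invr_ge0//.
  by apply: exprn_ile1; lra.
move=> u _; have [u4|u4] := boolP (4^-1 <= enorm u ^+ 2); last first.
  by apply: whp_sub (whpT _ (expR_ge0 (- (36 * K.+1%:R * s)))).
apply: (@whp_sub _ _ _ _ (expR (- (36 * K.+1%:R * s))) _ (ev (44 * y) (Sm u a) (S u))) => //.
have Ky : K.+1%:R * y <= 1.
  rewrite /y exprVn ler_pdivrMr ?exprn_gt0// mul1r -natrX ler_nat.
  exact: ltn_expl.
apply: (@whp_ev _ _ (4 * a) 1) => //.
- rewrite [X in X + _](_ : _ = 0) ?add0r; last first.
    rewrite (_ : Sm u a `\` S u = set0) /pr ?measure0//.
    by apply/seteqP; split=> // x [[]].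
  apply: le_trans (pr_Band u4 (ltW a_gt0)); apply: pr_le => //; first exact: measurableD.
  by move=> x [Hx nx]; apply: contrapT => nb; apply: nx; split.
- by rewrite ltr01 lexx.
- rewrite ler_expR lerN2.
  have h1 : K.+1%:R * s <= K.+1%:R * (n%:R * y ^+ 2) by rewrite ler_wpM2l.
  have h2 : n%:R * y * (K.+1%:R * y) <= n%:R * y * 1.
    by rewrite ler_wpM2l// mulr_ge0// ltW.
  have h3 : n%:R * (y * y) <= n%:R * (y * 1).
    by rewrite ler_wpM2l ?(ltW nR)// ler_wpM2l// ltW.
  by rewrite /a; lra.
Qed.

(* The quadratic form of the empirical covariance of the weighted sample. *)
Let V w v := \sum_(i < n) f (X i w) * l v (X i w) ^+ 2.

Let E3 w := forall v, V w v <= 192 * n%:R * enorm v ^+ 2.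

Let whp_E3 : whp Pr (delta / 16) E3.
Proof.
have -> : delta / 16 = delta * 16^-1 ^+ 1 by rewrite expr1.
apply: whp_sub (whp_net (k := 0) (E := fun u w =>
    enorm u ^+ 2 <= 5 / 2 -> V w u <= 48 * n%:R) _) => //.
  move=> w /= netw.
  pose b i := A^T *m colv (X i w).
  pose M := \sum_(i < n) f (X i w) *: (b i *m (b i)^T).
  have qM v : qform M v = V w v.
    have -> : qform M v = \sum_(i < n) f (X i w) * qform (b i *m (b i)^T) v.
      rewrite /qform /M mulmx_sumr mulmx_suml summxE; apply: eq_bigr => i _.
      by rewrite -scalemxAr -scalemxAl mxE.
    apply: eq_bigr => i _; congr (_ * _).
    rewrite /qform mulmxA -mulmxA mxE big_ord_recl big_ord0 addr0 expr2.
    have -> : (v^T *m b i) 0 0 = l v (X i w).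
      by rewrite /b mulmxA /dotp trmx_mul.
    congr (_ * _); rewrite -[(b i)^T *m v]trmxK trmx_mul trmxK mxE.
    by rewrite /b mulmxA /dotp trmx_mul.
  have MT : M^T = M.
    rewrite /M linear_sum; apply: eq_bigr => i _.
    by rewrite linearZ /= trmx_mul trmxK.
  have M0 v : 0 <= qform M v.
    rewrite qM; apply: sumr_ge0 => i _; rewrite mulr_ge0 ?sqr_ge0//.
    by have /andP[] := f_itv (X i w).
  move=> v; rewrite -qM.
  have := @qform_net_le _ _ M (net 0) (48 * n%:R) MT M0.
  have -> : 4 * (48 * n%:R) = 192 * n%:R :> R by ring.
  apply.
  - by move=> {}v v1; have [u u0 vu] := net_near 0 v1; exists u => //; move: vu; rewrite expr0 invr1 mulr1.
  - by move=> u u0 u52; rewrite qM; exact: netw.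
move=> u _; have [u52|u52] := boolP (enorm u ^+ 2 <= 5 / 2); last first.
  by apply: whp_sub (whpT _ (expR_ge0 (- (36 * 1%:R * s)))).
apply: whp_sub (covariance_point iidX c0_itv mf f_itv f_int law u52) => //.
by rewrite ler_expR lerN2 mulr1.
Qed.

Let sum_xk j : \sum_(k < j) xk k <= 240 * y.
Proof.
suff -> : \sum_(k < j) xk k = y * (240 - 2^-1 ^+ j * (96 + 36 * (2 * j%:R + 4))).
  have h : 0 <= 2^-1 ^+ j * (96 + 36 * (2 * j%:R + 4)) :> R.
    by rewrite mulr_ge0 ?exprn_ge0 ?invr_ge0// addr_ge0// mulr_ge0// addr_ge0// mulr_ge0.
  have : 0 <= y * (2^-1 ^+ j * (96 + 36 * (2 * j%:R + 4))) by rewrite mulr_ge0// ltW.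
  lra.
elim: j => [|j IHj]; first by rewrite big_ord0 expr0; ring.
by rewrite big_ord_recr /= IHj /xk exprS -natr1; field.
Qed.

(** [u k] approximates [v] in the [k]-th net.  Summing the increments carries
   the lower bound from [u 0] to the finest approximation [u K]; the margin [a]
   in [Sm] then absorbs the passage to [v], except for the sample points with a
   component larger than [a] along [v - u K], which are few by [E3]. *)
Let chain w v : E0 w -> E1 w -> E2 w -> E3 w -> enorm v = 1 ->
  n%:R * (c0 * fine (N H) - 380 * y) <= \sum_(i < n) \1_(S v) (X i w).
Proof.
move=> e0 e1 e2 e3 v1.
have [c00 c01] := andP c0_itv.
have /choice [u uP] : forall k, exists u, u \in net k /\ enorm (v - u) ^+ 2 <= 4^-1 * 64 ^- k.
  by move=> k; have [u uk vu] := net_near k v1; exists u.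
have uk k : u k \in net k by case: (uP k).
have vu k : enorm (v - u k) ^+ 2 <= 4^-1 * 64 ^- k by case: (uP k).
have p64 k : 0 < 64 ^- k :> R by rewrite invr_gt0 exprn_gt0.
have q64 k : 64 ^- k <= 1 :> R by rewrite -exprVn; apply: exprn_ile1; lra.
have s64 k : 64 ^- k.+1 <= 64 ^- k :> R.
  by rewrite -!exprVn exprS; have := exprn_ge0 k (x := 64^-1 : R) ltac:(lra); lra.
have u4 k : 4^-1 <= enorm (u k) ^+ 2.
  have := enorm_sqr_le v (u k); have := vu k; have := q64 k; rewrite v1 expr1n; lra.
have uu k : enorm (u k.+1 - u k) ^+ 2 <= 64 ^- k.
  have := enorm_sqrB_le (u k.+1) v (u k); have := vu k; have := vu k.+1.
  have := s64 k; rewrite (enorm_subC (u k.+1) v); lra.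
have climb j : (j <= K)%N ->
    n%:R * (c0 * pr (S (u j)) - 38 * y - \sum_(k < j) xk k) <= Sf w (S (u j)).
  elim: j => [_|j IHj jK].
    have := e0 _ (uk 0) (u4 0); rewrite /ev big_ord0 subr0.
    have -> : Sf w set0 = 0 by apply: big1 => i _; rewrite indic0 mulr0.
    by have -> : pr set0 = 0 by [rewrite /pr measure0]; rewrite !subr0.
  have := e1 j jK _ _ (uk j.+1) (uk j) (u4 j.+1) (u4 j) (uu j).
  have := IHj (ltnW jK); rewrite /ev big_ord_recr /= !mulrBr.
  by lra.
have top : n%:R * (c0 * pr (Sm (u K) a) - 322 * y) <= Sf w (Sm (u K) a).
  have := e2 _ (uk K) (u4 K); have := climb K (leqnn K); rewrite /ev.
  have : n%:R * \sum_(k < K) xk k <= n%:R * (240 * y) by rewrite ler_wpM2l.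
  lra.
have a2 : a ^+ 2 != 0 by rewrite expf_neq0// gt_eqF.
have y6 : 64 ^- K = y ^+ 6 :> R.
  by rewrite /y -exprM mulnC exprM -exprVn; congr (_ ^+ _); field.
have T1 : Sf w (Tail (v - u K) a) <= n%:R * (48 * y).
  apply: (@le_trans _ _ (V w (v - u K) / a ^+ 2)).
    rewrite /V mulr_suml; apply: ler_sum => i _.
    have /andP[f0 _] := f_itv (X i w); rewrite -mulrA ler_wpM2l//.
    rewrite indicE; case: (boolP (_ \in _)) => [|_]; last by rewrite divr_ge0// sqr_ge0.
    rewrite inE /Tail /tail /= => h; rewrite ler_pdivlMr ?exprn_gt0// mul1r.
    by rewrite -[leRHS]real_normK ?num_real// lerXn2r ?nnegrE ?(ltW a_gt0)// ltW.
  rewrite ler_pdivrMr ?exprn_gt0//; apply: (le_trans (e3 _)).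
  apply: (@le_trans _ _ (192 * n%:R * (4^-1 * y ^+ 6))).
    by rewrite ler_wpM2l ?mulr_ge0// -y6 vu.
  have -> : 192 * n%:R * (4^-1 * y ^+ 6) = n%:R * (48 * y ^+ 4) * (y * y) by field.
  have -> : n%:R * (48 * y) * a ^+ 2 = n%:R * (48 * y ^+ 4) * y by rewrite /a; ring.
  rewrite ler_wpM2l//; last by rewrite -[leRHS]mulr1 ler_wpM2l// ltW.
  by rewrite !mulr_ge0// exprn_ge0// ltW.
have T2 : pr (S v) <= pr (Sm (u K) a) + 10 * y.
  have a2y : a <= y by rewrite /a expr2 -[leRHS]mulr1 ler_wpM2l// ltW.
  have B1 : pr (Band v (2 * a)) <= 8 * a.
    apply: (le_trans (pr_Band _ _)); [by rewrite v1 expr1n; lra|by rewrite mulr_ge0// ltW|lra].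
  have B2 : pr (Tail (v - u K) a) <= 2 * a.
    apply: (le_trans (pr_Tail _ a_gt0)).
    rewrite ler_pdivrMr ?exprn_gt0//.
    have -> : 2 * a * a ^+ 2 = 8 * (4^-1 * y ^+ 6) by rewrite /a; field.
    by rewrite ler_wpM2l// -y6 vu.
  have h : S v `<=` Sm (u K) a `|` (Band v (2 * a) `|` Tail (v - u K) a).
    move=> x Hv; rewrite /Sm /Band /Tail /band /tail /=.
    have [h1|h1] := leP `| `|l v x| - t| (2 * a); first by right; left.
    have [h2|h2] := ltP a `|l (v - u K) x|; first by right; right.
    rewrite lB in h2; left; split.
      apply: contrapT => nH; have := H_cross Hv nH; rewrite /= in h1 h2 *; have := a_gt0; lra.
    move=> h3; have := ler_dist_dist (l v x) (l (u K) x).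
    have := ler_normD (`|l v x| - `|l (u K) x|) (`|l (u K) x| - t).
    by rewrite addrA subrK /= in h1 h2 h3 * => h4 h5; lra.
  have := pr_leU (mS v) (mSm (u K) a) (measurableU _ _ (mBand v (2 * a)) (mTail (v - u K) a)) h.
  have := pr_leU (measurableU _ _ (mBand v (2 * a)) (mTail (v - u K) a)) (mBand v (2 * a)) (mTail (v - u K) a) (@subset_refl _ _).
  lra.
have T3 : Sf w (Sm (u K) a) - Sf w (Tail (v - u K) a) <= \sum_(i < n) \1_(S v) (X i w).
  rewrite /Sf -sumrB; apply: ler_sum => i _; rewrite -mulrBr.
  have /andP[f0 f1] := f_itv (X i w); set x := X i w in f0 f1 *.
  rewrite !indicE; case: (boolP (x \in Tail _ _)) => [_|nT].
    apply: (@le_trans _ _ 0) => //.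
    by rewrite mulr_ge0_le0// subr_le0; case: (_ \in _).
  rewrite subr0; case: (boolP (x \in Sm _ _)) => [|_]; last by rewrite mulr0.
  rewrite inE /Sm /= => -[Hu nb]; rewrite mem_set ?mulr1//.
  apply: contrapT => nHv; apply: nb; rewrite /band /=.
  apply: (le_trans (H_cross Hu nHv)).
  by move: nT; rewrite notin_setE /Tail /tail /= lB => /negP; rewrite -leNgt distrC.
have T4 : pr (S v) = fine (N H).
  by rewrite /pr /S law// v1; congr (fine (N _)); apply/seteqP; split=> z /=; rewrite mul1r.
have T5 : n%:R * (c0 * pr (S v)) <= n%:R * (c0 * pr (Sm (u K) a) + 10 * y).
  have h1 : c0 * pr (S v) <= c0 * (pr (Sm (u K) a) + 10 * y) by rewrite ler_wpM2l.
  have h2 : c0 * (10 * y) <= 1 * (10 * y) by rewrite ler_wpM2r// mulr_ge0// ltW.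
  by rewrite ler_wpM2l//; lra.
rewrite T4 in T5.
lra.
Qed.

Lemma chaining_lower_bound : whp Pr (delta / 2)
  [set w | forall v, enorm v = 1 ->
     n%:R * (c0 * fine (N H) - 380 * y) <= \sum_(i < n) \1_H (l v (X i w))].
Proof.
have /andP[d0 _] := delta01.
apply: whp_sub (whpI (whpI whp_E0 whp_E1) (whpI whp_E2 whp_E3)); first lra.
move=> w [[e0 e1] [e2 e3]] v v1; apply: (le_trans (chain e0 e1 e2 e3 v1)).
by apply: ler_sum => i _; rewrite !indicE le_eqVlt; apply/orP; left; apply/eqP; congr (nat_of_bool _)%:R; apply/idP/idP; rewrite !inE.
Qed.

End chaining.

(** * Uniform lower bound for contaminated samples *)

Section uniform.
Context {R : realType}.
Notation N := (normal_prob (0 : R) 1).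

Lemma dyadic_scale (rho : R) : 0 < rho <= 1 ->
  exists K, rho <= (2^-1 ^+ K) ^+ 2 /\ (2^-1 : R) ^+ K <= 2 * Num.sqrt rho.
Proof.
move=> /andP[r0 r1].
have e k : (2^-1 ^+ k) ^+ 2 = 4^-1 ^+ k :> R.
  by rewrite -exprM mulnC exprM; congr (_ ^+ _); field.
have ex : exists k, 4^-1 ^+ k.+1 < rho.
  have [m mr] : exists m, rho^-1 < m%:R.
    by exists (Num.bound rho^-1); apply: le_lt_trans (archi_boundP _); rewrite ?ler_norm ?invr_ge0 ?(ltW r0).
  exists m; rewrite exprVn -[ltRHS]invrK ltf_pV2 ?posrE ?invr_gt0 ?exprn_gt0//.
  apply: (lt_le_trans mr); rewrite -natrX ler_nat.
  by apply: ltnW; apply: ltn_trans (ltn_expl _ _).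
have [K hK minK] := ex_minnP ex.
exists K; split.
  rewrite e; case: K hK minK => [|K] hK minK; first by rewrite expr0.
  by rewrite leNgt; apply/negP => /minK; rewrite ltnn.
rewrite -(@ler_pXn2r _ 2%N)// ?nnegrE ?mulr_ge0 ?sqrtr_ge0 ?exprn_ge0 ?invr_ge0//.
rewrite e exprMn sqr_sqrtr ?(ltW r0)//.
by move: hK; rewrite exprS; lra.
Qed.

Lemma posdef_unitmx {p : nat} (Sigma : 'M[R]_p) : posdef Sigma -> Sigma \in unitmx.
Proof.
move=> [ST S0]; apply: contrapT => /negP nu.
have : kermx Sigma != 0 by rewrite kermx_eq0 row_free_unit.
move=> /rowV0Pn [v /sub_kermxP vS v0].
have := S0 v^T; rewrite trmx_eq0 => /(_ v0).
by rewrite /qform trmxK vS mul0mx mxE ltxx.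
Qed.

Context {d : measure_display} {Omega : measurableType d}.
Context {p n : nat} {Pr : probability Omega R}.
Context {P P0 : probability (p.-tuple R) R} {X : 'I_n -> {RV Pr >-> p.-tuple R}}.

(** With [Sigma = L L^T], the vectors [u = (L^T)^-1 v] with [|v| = 1] give all
   directions, and [u^T X] is standard normal under [P0]; the chaining is done
   over [v]. *)
Lemma uniform_lower_bound (eps delta t : R) (Sigma : 'M[R]_p) (H : set R) :
  (0 < p)%N -> (0 < n)%N -> iid_sample P X ->
  0 <= eps <= 1 -> 0 < delta < 1 -> 36 * (p%:R + ln (1 / delta)) <= n%:R ->
  posdef Sigma -> normal_vec Sigma P0 -> contaminated eps P0 P ->
  measurable H -> (forall x y, H x -> ~ H y -> `| `|x| - t | <= `|x - y|) ->
  whp Pr (delta / 2) [set w | forall u, unit_sphere u ->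
    n%:R * ((1 - eps) * fine (N H) - 760 * Num.sqrt ((p%:R + ln (1 / delta)) / n%:R)) <=
    \sum_(i < n) \1_[set x | H (dotp u x / Num.sqrt (qform Sigma u))] (X i w)].
Proof.
move=> p0 n0 iidX /andP[e0 e1] d01 sn pdS nS [G PG] mH Hx.
have nR : 0 < n%:R :> R by rewrite ltr0n.
have pR : 1 <= p%:R :> R by rewrite ler1n.
have Lge : 0 <= ln (1 / delta).
  by have /andP[d0 d1] := d01; rewrite ln_ge0// mul1r invf_ge1// ltW.
set s := p%:R + _ in sn *; have s1 : 1 <= s by rewrite /s; lra.
pose rho := s / n%:R.
have rho01 : 0 < rho <= 1.
  by rewrite divr_gt0 ?ler_pdivrMr// ?mul1r; lra.
have [K [K1 K2]] := dyadic_scale rho01.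
have [L [Q [LS _ _]]] := nS.
have Su := posdef_unitmx pdS.
have Lu : L^T \in unitmx.
  by move: Su; rewrite -LS unitmx_mul unitmx_tr => /andP[].
pose A := invmx L^T.
have law v (B : set R) : measurable B ->
    P0 [set x | B (dotp (A *m v) x)] = N [set z | B (enorm v * z)].
  move=> mB; rewrite (normal_vec_dotp _ nS mB) -LS qform_gram mulKVmx//.
  by rewrite sqrtr_sqr ger0_norm// enorm_ge0.
have c0 : 0 <= 1 - eps by lra.
have leP B : measurable B -> ((1 - eps)%:E * P0 B <= P B)%E.
  by move=> mB; rewrite PG// leeDl// mule_ge0.
have [f [mf f01 fint]] := bounded_density c0 leP.
have c01 : 0 <= 1 - eps <= 1 by apply/andP; split; lra.
have /choice [net netP] : forall k, exists net : seq 'cV[R]_p,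
    (size net)%:R <= expR (7 * k.+1%:R * p%:R) :> R /\
    forall v, enorm v = 1 -> exists2 w, w \in net & enorm (v - w) ^+ 2 <= 4^-1 * 64 ^- k.
  by move=> k; exact: sphere_net.
have sy : s <= n%:R * (2^-1 ^+ K) ^+ 2.
  by move: K1; rewrite /rho ler_pdivrMr// mulrC.
have key := @chaining_lower_bound R d Omega p n Pr P P0 X p0 n0 iidX (1 - eps) f A
  c01 mf f01 fint law H t mH Hx delta K d01 sy sn net
  (fun k => proj1 (netP k)) (fun k => proj2 (netP k)).
apply: whp_sub key => // w /= Hw u su.
have u0 := unit_sphere_neq0 su.
have q0 : 0 < qform Sigma u by case: pdS => _; exact.
set sg := Num.sqrt (qform Sigma u).
have sg0 : 0 < sg by rewrite sqrtr_gt0.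
pose v := sg^-1 *: (L^T *m u).
have v1 : enorm v = 1.
  apply: enorm_eq => //; rewrite /v enormZ -qform_gram LS exprVn sqr_sqrtr ?(ltW q0)//.
  by rewrite mulVf ?gt_eqF// expr1n.
have Av : A *m v = sg^-1 *: u by rewrite /v -scalemxAr mulKmx.
have dv x : dotp (A *m v) x = dotp u x / sg.
  by rewrite Av /dotp linearZ /= -scalemxAl mxE mulrC.
have := Hw v v1.
rewrite (eq_bigr (fun i => \1_[set x | H (dotp u x / sg)] (X i w))); last first.
  by move=> i _; rewrite !indicE dv; congr (nat_of_bool _)%:R; apply/idP/idP; rewrite !inE.
apply: le_trans; rewrite ler_wpM2l//.
rewrite -/s -/rho; lra.
Qed.

End uniform.

(** * From empirical frequencies to the deepest scatter matrix *)

Section deterministic.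
Context {R : realType} {p n : nat}.
Hypothesis n_gt0 : (0 < n)%N.
Variable x : 'I_n -> p.-tuple R.

Let cnt (B : set (p.-tuple R)) : R := \sum_(i < n) \1_B (x i).

Let nR : 0 < n%:R :> R. Proof. by rewrite ltr0n. Qed.

Lemma empiricalE (B : set (p.-tuple R)) : empirical x B = (cnt B / n%:R)%:E.
Proof.
rewrite /empirical /cnt mulrC EFinM; congr (_ * _)%E.
by rewrite -sumEFin; apply: eq_bigr => i _; rewrite diracE.
Qed.

Let cnt_sub (B C : set (p.-tuple R)) : B `<=` C -> cnt B <= cnt C.
Proof.
move=> BC; apply: ler_sum => i _; rewrite !indicE ler_nat.
by case: (boolP (x i \in B)) => // /set_mem /BC /mem_set ->.
Qed.

Let cnt_disjoint (B C : set (p.-tuple R)) : B `&` C `<=` set0 -> cnt B + cnt C <= n%:R.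
Proof.
move=> BC; rewrite /cnt -big_split /=.
apply: (@le_trans _ _ (\sum_(i < n) 1)); last by rewrite sumr_const card_ord.
apply: ler_sum => i _; rewrite !indicE.
case: (boolP (x i \in B)) => [/set_mem Bx|_]; case: (boolP (x i \in C)) => [/set_mem Cx|_] /=; try lra.
by case: (BC (x i)).
Qed.

Variables (Sigma : 'M[R]_p).
Hypothesis Sigma_pd : posdef Sigma.

Let sg u := Num.sqrt (qform Sigma u).
Let zz u (z : p.-tuple R) := dotp u z / sg u.

Let q_gt0 u : unit_sphere u -> 0 < qform Sigma u.
Proof. by move=> /unit_sphere_neq0; case: Sigma_pd => _; exact. Qed.

Let sg_gt0 u : unit_sphere u -> 0 < sg u.
Proof. by move=> su; rewrite sqrtr_gt0 q_gt0. Qed.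

Let zzE u z : unit_sphere u -> `|dotp u z| = `|zz u z| * sg u.
Proof.
move=> su; have s0 := sg_gt0 su.
by rewrite /zz normrM normfV (gtr0_norm s0) divfK// gt_eqF.
Qed.

Let sg2 u : unit_sphere u -> sg u ^+ 2 = qform Sigma u.
Proof. by move=> su; rewrite sqr_sqrtr// ltW// q_gt0. Qed.

Variables (b y0 D E : R).
Hypothesis b_gt0 : 0 < b.
Hypothesis y0_ge0 : 0 <= y0.
Hypothesis DE : 1 < D + E.
Hypothesis below : forall u, unit_sphere u -> n%:R * D <= cnt [set z | `|zz u z| <= b].
Hypothesis above : forall u, unit_sphere u -> n%:R * D <= cnt [set z | b <= `|zz u z|].
Hypothesis below' : forall u, unit_sphere u -> n%:R * E <= cnt [set z | `|zz u z| < b + y0].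
Hypothesis above' : 0 <= b - y0 ->
  forall u, unit_sphere u -> n%:R * E <= cnt [set z | b - y0 < `|zz u z|].

Let empirical_ge (B C : set (p.-tuple R)) : n%:R * D <= cnt C -> C `<=` B ->
  (D%:E <= empirical x B)%E.
Proof.
move=> h CB; rewrite empiricalE lee_fin ler_pdivlMr// mulrC.
by apply: (le_trans h); exact: cnt_sub.
Qed.

Lemma scatter_depth_ge : (D%:E <= scatter_depth (b ^+ 2 *: Sigma) (empirical x))%E.
Proof.
apply/ereal_infP => _ [u su <-].
have E2 : qform (b ^+ 2 *: Sigma) u = (b * sg u) ^+ 2.
  by rewrite exprMn sg2// /qform -scalemxAr -scalemxAl mxE.
have sge : 0 <= sg u := ltW (sg_gt0 su).
have bs : 0 <= b * sg u by rewrite mulr_ge0// ltW.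
have zs z : 0 <= `|zz u z| * sg u by rewrite mulr_ge0.
rewrite le_min; apply/andP; split.
- apply: (empirical_ge (below su)) => z /= h; rewrite E2 (zzE _ su).
  by rewrite lerXn2r ?nnegrE// ler_wpM2r.
- apply: (empirical_ge (above su)) => z /= h; rewrite E2 (zzE _ su).
  by rewrite lerXn2r ?nnegrE// ler_wpM2r.
Qed.

(** By maximality [Gamma] has depth at least [D].  In direction [u], let [c] be
   the square root of its form, in units of [sg u].  If [c > b + y0], the events
   [|z| >= c] and [|z| < b + y0] are disjoint with frequencies at least [D] and
   [E], which contradicts [1 < D + E]; the case [c < b - y0] is symmetric. *)
Lemma deepest_scatter_close (Gamma : 'M[R]_p) u :
  deepest_scatter (empirical x) Gamma -> unit_sphere u ->
  `|qform ((b ^+ 2)^-1 *: Gamma - Sigma) u| <=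
    qform Sigma u * (y0 * (2 * b + y0) / b ^+ 2).
Proof.
move=> [[GT G0] Gmax] su.
have [ST S0] := Sigma_pd.
have psdS : psd (b ^+ 2 *: Sigma).
  split; first by rewrite linearZ /= ST.
  move=> v; rewrite /qform -scalemxAr -scalemxAl mxE mulr_ge0 ?sqr_ge0//.
  have [->|v0] := eqVneq v 0; first by rewrite mulmx0 mxE.
  exact: ltW (S0 v v0).
have depthG := le_trans scatter_depth_ge (Gmax _ psdS).
have : (D%:E <= mine (empirical x [set z | (`|dotp u z| ^+ 2 <= qform Gamma u)%R])
                     (empirical x [set z | (qform Gamma u <= `|dotp u z| ^+ 2)%R]))%E.
  by apply: (le_trans depthG); apply: ereal_inf_lbound; exists u.
rewrite le_min !empiricalE !lee_fin !ler_pdivlMr// ![D * _]mulrC => /andP[lowG highG].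
have s0 := sg_gt0 su.
pose c := Num.sqrt (qform Gamma u) / sg u.
have c0 : 0 <= c by rewrite divr_ge0 ?sqrtr_ge0// ltW.
have Gc : qform Gamma u = (c * sg u) ^+ 2.
  by rewrite /c divfK ?gt_eqF// sqr_sqrtr.
have cs0 : 0 <= c * sg u by rewrite mulr_ge0// ltW.
have zs z : 0 <= `|zz u z| * sg u by rewrite mulr_ge0// ltW.
have nDE : n%:R < n%:R * D + n%:R * E by rewrite -mulrDr -[ltLHS]mulr1 ltr_pM2l.
have c_le : c <= b + y0.
  rewrite leNgt; apply/negP => hc.
  have : cnt [set z | (qform Gamma u <= `|dotp u z| ^+ 2)%R] + cnt [set z | `|zz u z| < b + y0] <= n%:R.
    apply: cnt_disjoint => z [/= h1 h2].
    move: h1; rewrite Gc (zzE _ su) ler_pXn2r ?nnegrE//.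
    by rewrite ler_pM2r// leNgt (lt_trans h2 hc).
  move=> h; by have := lt_le_trans nDE (le_trans (lerD highG (below' su)) h); rewrite ltxx.
have c_ge : b - y0 <= c.
  rewrite leNgt; apply/negP => hc.
  have by0 : 0 <= b - y0 by apply: ltW; exact: le_lt_trans hc.
  have : cnt [set z | (`|dotp u z| ^+ 2 <= qform Gamma u)%R] + cnt [set z | b - y0 < `|zz u z|] <= n%:R.
    apply: cnt_disjoint => z [/= h1 h2].
    move: h1; rewrite Gc (zzE _ su) ler_pXn2r ?nnegrE//.
    by rewrite ler_pM2r// leNgt (lt_trans hc h2).
  move=> h; by have := lt_le_trans nDE (le_trans (lerD lowG (above' by0 su)) h); rewrite ltxx.
have b2 : 0 < b ^+ 2 by rewrite exprn_gt0.
have -> : qform ((b ^+ 2)^-1 *: Gamma - Sigma) u =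
          qform Sigma u * ((c ^+ 2 - b ^+ 2) / b ^+ 2).
  have -> : qform ((b ^+ 2)^-1 *: Gamma - Sigma) u =
            (b ^+ 2)^-1 * qform Gamma u - qform Sigma u.
    have subE k (Y Z : 'M[R]_1) : (k *: Y - Z) 0 0 = k * Y 0 0 - Z 0 0 by rewrite !mxE.
    by rewrite /qform mulmxBr mulmxBl -scalemxAr -scalemxAl subE.
  by rewrite Gc exprMn (sg2 su); field; rewrite gt_eqF.
rewrite normrM (gtr0_norm (q_gt0 su)) ler_wpM2l ?(ltW (q_gt0 su))//.
rewrite normrM (ger0_norm (x := (b ^+ 2)^-1)) ?invr_ge0 ?(ltW b2)//.
rewrite ler_pM2r ?invr_gt0//.
have -> : c ^+ 2 - b ^+ 2 = (c - b) * (c + b) by ring.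
have h1 : `|c - b| <= y0 by rewrite ler_norml; apply/andP; split; lra.
have h2 : `|c + b| <= 2 * b + y0.
  by have := b_gt0; have := y0_ge0; rewrite ler_norml => ? ?; apply/andP; split; lra.
by rewrite normrM ler_pM.
Qed.

End deterministic.

(** * Calibration of the radius and conclusion *)

Section crossing.
Context {R : realType}.
Implicit Types t x y : R.

Lemma crossing_le t x y : (`|x| <= t <= `|y|) || (`|y| <= t <= `|x|) ->
  `| `|x| - t | <= `|x - y|.
Proof.
move=> h; apply: le_trans (ler_dist_dist x y); case/orP: h => /andP[h1 h2].
  rewrite distrC (distrC `|x| `|y|) ger0_norm ?subr_ge0//.
  by apply: le_trans (ler_norm _); rewrite lerB.
by rewrite ger0_norm ?subr_ge0//; apply: le_trans (ler_norm _); rewrite lerB.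
Qed.

End crossing.

Section calibration.
Context {R : realType}.
Notation N := (normal_prob (0 : R) 1).

Definition median_abs : R := Phi_inv (3 / 4).
Notation b := median_abs.

Lemma median_absP : Phi b = 3 / 4 /\ 0 < b.
Proof.
have [Pb b0] : Phi b = 3 / 4 /\ 0 <= b by apply: Phi_invK; apply/andP; split; lra.
split=> //; rewrite lt_neqAle b0 andbT; apply/eqP => b00.
by move: Pb; rewrite -b00 Phi0; lra.
Qed.

Lemma betaE : beta = b ^+ 2. Proof. by []. Qed.

Let q (e : R) : R := (3 - e) / (4 * (1 - e)).

Let q_le e f : e <= f -> f < 1 -> q e <= q f.
Proof.
move=> ef f1; rewrite /q ler_pdivrMr; last by lra.
rewrite mulrAC ler_pdivlMr; last by lra.
lra.
Qed.

Let q0 : q 0 = 3 / 4. Proof. by rewrite /q; field. Qed.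

Let q_lt1 e : e < 1 / 3 -> q e < 1.
Proof. by move=> e3; rewrite /q ltr_pdivrMr; lra. Qed.

Let tau (e : R) := Phi_inv (q e).

Let tauP e : 0 <= e < 1 / 3 -> Phi (tau e) = q e.
Proof.
move=> /andP[e0 e1].
have h : 2^-1 <= q e < 1.
  apply/andP; split; last exact: q_lt1.
  by have := @q_le 0 e e0 ltac:(lra); rewrite q0; lra.
by have [] := Phi_invK h.
Qed.

Let b_le_tau e : 0 <= e < 1 / 3 -> b <= tau e.
Proof.
move=> e01; rewrite -Phi_le tauP// (proj1 median_absP) -q0 q_le//; lra.
Qed.

Lemma B_E_tau e : b * B_E e = tau e - b.
Proof.
have [_ b0] := median_absP.
rewrite /B_E betaE sqrtr_sqr (gtr0_norm b0) -/(q e) -/(tau e) mulrBr mulr1.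
by rewrite mulVKf// gt_eqF.
Qed.

(** At [r = 0] and [y = b B_E e] the two frequencies add up to exactly 1.  The
   slope of [Phi] is at least some [g > 0] up to [b + y], which stays bounded since
   [e' < 1 / 3]; it converts the surplus [2 r / g] into the slack needed for [r]. *)
Lemma B_E_calibration (e' : R) : 0 < e' < 1 / 3 ->
  exists g T, [/\ 0 < g, 0 < T &
    forall e r, 0 <= e <= e' -> 0 < r -> 2 * r <= g ->
      let y := b * B_E e + 2 * r / g in
      0 <= y <= T /\
      1 < (1 - e) / 2 - r + ((1 - e) * (2 * Phi (b + y) - 1) - r)].
Proof.
move=> /andP[e'0 e'3]; have [Pb b0] := median_absP.
have T0 : b <= tau e' by apply: b_le_tau; apply/andP; split; lra.
pose g : R := normal_pdf 0 1 (tau e' + 1).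
have g0 : 0 < g := normal_pdf_gt0 _.
exists g, (tau e' + 1); split; [by []|by lra|].
move=> e r /andP[e0 e1] r0 rg y.
have e3 : 0 <= e < 1 / 3 by apply/andP; split; lra.
have bt := b_le_tau e3.
have tt : tau e <= tau e'.
  rewrite -Phi_le (tauP e3) tauP; last by apply/andP; split; lra.
  by apply: q_le => //; lra.
have xi0 : 0 < 2 * r / g by rewrite divr_gt0// mulr_gt0.
have xi1 : 2 * r / g <= 1 by rewrite ler_pdivrMr// mul1r.
have yE : y = tau e - b + 2 * r / g by rewrite /y B_E_tau.
split; first by apply/andP; split; lra.
have slope : 2 * r <= Phi (b + y) - Phi (tau e).
  have -> : 2 * r = (b + y - tau e) * g.
    by rewrite yE; field; rewrite gt_eqF.
  by apply: Phi_sub_ge; lra.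
rewrite tauP// in slope.
have h1 : (1 - e) * q e = (3 - e) / 4 by rewrite /q; field; lra.
have h2 : (1 - e) * (q e + 2 * r) <= (1 - e) * Phi (b + y).
  by apply: ler_wpM2l; lra.
have h3 : 2 / 3 * r <= (1 - e) * r by apply: ler_wpM2r; lra.
rewrite mulrDr h1 in h2; clear -h2 h3 r0; lra.
Qed.

Context {d : measure_display} {Omega : measurableType d}.
Context {p n : nat} {Pr : probability Omega R}.
Context {P P0 : probability (p.-tuple R) R} {X : 'I_n -> {RV Pr >-> p.-tuple R}}.

(** The lower bounds for [|z| < b + y] and [|z| > b - y] can be given the same
   value because the normal mass between [b - y] and [b] is at least that
   between [b] and [b + y], by [Phi_reflect]. *)
Lemma deepest_scatter_whp (eps delta y : R) (Sigma : 'M[R]_p) :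
  let r := 760 * Num.sqrt ((p%:R + ln (1 / delta)) / n%:R) in
  (0 < p)%N -> (0 < n)%N -> iid_sample P X ->
  0 <= eps <= 1 -> 0 < delta < 1 -> 36 * (p%:R + ln (1 / delta)) <= n%:R ->
  posdef Sigma -> normal_vec Sigma P0 -> contaminated eps P0 P -> 0 <= y ->
  1 < (1 - eps) / 2 - r + ((1 - eps) * (2 * Phi (b + y) - 1) - r) ->
  whp Pr (2 * delta) [set w | forall Gamma u,
    deepest_scatter (empirical (fun i => X i w)) Gamma -> unit_sphere u ->
    `|qform (beta^-1 *: Gamma - Sigma) u| <=
      qform Sigma u * (y * (2 * b + y) / b ^+ 2)].
Proof.
have aux (v w : R) : v - 3 / 4 <= 3 / 4 - w -> 2 * v - 1 <= 2 - 2 * w by lra.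
move=> r p0 n0 iidX e01 d01 sn pdS nS PP y0 DE.
have [Pb b0] := median_absP.
have low (H : set R) t := @uniform_lower_bound R d Omega p n Pr P P0 X eps delta t Sigma H
  p0 n0 iidX e01 d01 sn pdS nS PP.
have by0 : 0 <= b + y by rewrite addr_ge0// ltW.
have [N1 _ N2 _] := normal_slab (ltW b0).
have [_ N3 _ _] := normal_slab by0.
have c1 (x z : R) : `|x| <= b -> ~ `|z| <= b -> `| `|x| - b| <= `|x - z|.
  by move=> h /negP; rewrite -ltNge => /ltW k; apply: crossing_le; rewrite h k.
have c2 (x z : R) : b <= `|x| -> ~ b <= `|z| -> `| `|x| - b| <= `|x - z|.
  by move=> h /negP; rewrite -ltNge => /ltW k; apply: crossing_le; rewrite h k orbT.
have c3 (x z : R) : `|x| < b + y -> ~ `|z| < b + y -> `| `|x| - (b + y)| <= `|x - z|.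
  by move=> /ltW h /negP; rewrite -leNgt => k; apply: crossing_le; rewrite h k.
have c4 (x z : R) : b - y < `|x| -> ~ b - y < `|z| -> `| `|x| - (b - y)| <= `|x - z|.
  by move=> /ltW h /negP; rewrite -leNgt => k; apply: crossing_le; rewrite h k orbT.
apply: whp_sub
  (whpI (whpI (low _ _ (measurable_norm_le b) c1) (low _ _ (measurable_norm_ge b) c2))
        (whpI (low _ _ (measurable_norm_lt (b + y)) c3)
              (low _ _ (measurable_norm_gt (b - y)) c4))).
  by rewrite -!mulrDr; lra.
move=> w [[W1 W2] [W3 W4]] Gamma u deepG su.
have D1 : (1 - eps) * fine (N [set x : R | `|x| <= b]) - r = (1 - eps) / 2 - r.
  by rewrite N1 /= Pb; field.
have D2 : (1 - eps) * fine (N [set x : R | b <= `|x|]) - r = (1 - eps) / 2 - r.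
  by rewrite N2 /= Pb; field.
have D3 : (1 - eps) * fine (N [set x : R | `|x| < b + y]) - r =
          (1 - eps) * (2 * Phi (b + y) - 1) - r by rewrite N3.
have D4 : 0 <= b - y -> (1 - eps) * (2 * Phi (b + y) - 1) - r <=
    (1 - eps) * fine (N [set x : R | b - y < `|x|]) - r.
  move=> yb; have [_ _ _ N4] := normal_slab yb; rewrite N4 /= lerD2r.
  have /andP[e0 e1] := e01; apply: ler_wpM2l; first by rewrite subr_ge0.
  have := Phi_reflect (ltW b0) y0; rewrite Pb.
  exact: aux.
rewrite betaE.
apply: (deepest_scatter_close n0 (x := fun i => X i w) pdS b0 y0 DE _ _ _ _ deepG su).
- by move=> v sv; rewrite -D1; exact: W1.
- by move=> v sv; rewrite -D2; exact: W2.
- by move=> v sv; rewrite -D3; exact: W3.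
- move=> yb v sv; apply: le_trans (W4 v sv); apply: ler_wpM2l => //; exact: D4.
Qed.

End calibration.

Theorem lemma8 (R : realType) (M eps' : R) (M_gt0 : 0 < M)
    (eps'_gt0 : 0 < eps') (eps'_lt : eps' < 1 / 3) :
  exists c Cstar : R, 0 < c /\ 0 < Cstar /\
  forall (eps delta : R) (p n : nat),
    0 <= eps <= eps' -> 0 < delta < 1 / 2 -> (0 < p)%N -> (0 < n)%N ->
    (p%:R + ln (1 / delta)) / n%:R <= c ->
  forall (Sigma : 'M[R]_p) (P0 P : probability (p.-tuple R) R),
    spd_below M Sigma -> normal_vec Sigma P0 -> contaminated eps P0 P ->
  forall (d : measure_display) (Omega : measurableType d)
    (Pr : probability Omega R) (X : 'I_n -> {RV Pr >-> p.-tuple R})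
    (Gammahat : Omega -> 'M[R]_p),
    iid_sample P X ->
    (forall w, deepest_scatter (empirical (fun i => X i w)) (Gammahat w)) ->
  ((1 - 2 * delta)%:E <=
    inner_prob Pr [set w |
      (opnorm (beta^-1 *: Gammahat w - Sigma) ^+ 2 <=
        Cstar * (Num.max (p%:R / n%:R) (B_E eps ^+ 2)
                 + ln (1 / delta) / n%:R))%R])%E.
Proof.
have e'01 : 0 < eps' < 1 / 3 by rewrite eps'_gt0.
have [g [T [g0 T0 calib]]] := B_E_calibration e'01.
have [_ b0] := @median_absP R.
set b := median_abs in b0 calib.
(* Large numerals are kept opaque, since unification would unfold them. *)
have [k kE] : exists k : R, k = 760 by exists 760.
have k0 : 0 < k by rewrite kE; lra.
pose C1 := M * (2 * b + T) / b ^+ 2.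
have C10 : 0 < C1.
  by rewrite !mulr_gt0 ?invr_gt0 ?exprn_gt0// addr_gt0// mulr_gt0.
have gk : 0 < g / (2 * k) by rewrite divr_gt0// mulr_gt0.
have C2 : 0 < 2 * b ^+ 2 by rewrite mulr_gt0 ?exprn_gt0.
have C3 : 0 < 8 * k ^+ 2 / g ^+ 2 by rewrite divr_gt0 ?mulr_gt0 ?exprn_gt0.
exists (Num.min 36^-1 ((g / (2 * k)) ^+ 2)), (C1 ^+ 2 * (2 * b ^+ 2 + 8 * k ^+ 2 / g ^+ 2)).
split; first by rewrite lt_min invr_gt0 exprn_gt0// ltr0n.
split; first by rewrite mulr_gt0 ?exprn_gt0// addr_gt0.
move=> eps delta p n e01 d01 p0 n0 hc Sigma P0 P [pdS eigS] nS PP d Omega Pr X Gh iidX Ghat.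
have nR : 0 < n%:R :> R by rewrite ltr0n.
have d1 : 0 < delta < 1 by case/andP: d01 => d0 d1; rewrite d0/=; clear -d1; lra.
have Lge : 0 <= ln (1 / delta).
  by case/andP: d1 => ? ?; rewrite ln_ge0// mul1r invf_ge1// ltW.
have pR : 0 < p%:R :> R by rewrite ltr0n.
set L := ln (1 / delta) in hc Lge *.
pose rho := (p%:R + L) / n%:R.
have rho0 : 0 < rho by rewrite divr_gt0// ltr_wpDr.
move: hc; rewrite -/rho le_min => /andP[hc1 hc2].
have sn : 36 * (p%:R + L) <= n%:R.
  by move: hc1; rewrite /rho ler_pdivrMr// -ler_pdivlMl ?invr_gt0// invrK.
pose r := k * Num.sqrt rho.
have r0 : 0 < r by rewrite mulr_gt0// sqrtr_gt0.
have rg : 2 * r <= g.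
  have : Num.sqrt rho <= g / (2 * k).
    rewrite -(@ler_pXn2r _ 2%N) ?nnegrE ?sqrtr_ge0 ?(ltW gk)//.
    by rewrite sqr_sqrtr ?(ltW rho0).
  by rewrite ler_pdivlMr ?mulr_gt0// /r mulrC mulrA.
have [y01 DE] := calib eps r e01 r0 rg.
set y := b * B_E eps + 2 * r / g in y01 DE.
have /andP[y0 y1] := y01.
have e1 : 0 <= eps <= 1.
  by case/andP: e01 => -> h; clear -h eps'_lt; lra.
have rE : r = 760 * Num.sqrt ((p%:R + ln (1 / delta)) / n%:R) by rewrite /r kE.
rewrite rE in DE.
have key := deepest_scatter_whp p0 n0 iidX e1 d1 sn pdS nS PP y0 DE.
apply: whp_inner_prob; apply: whp_sub key => // w /= close.
pose A := beta^-1 *: Gh w - Sigma.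
have [[GT _] _] := Ghat w.
have [ST _] := pdS.
have AT : A^T = A by rewrite linearB linearZ /= GT ST.
have op_le : opnorm A <= C1 * y.
  apply: opnorm_sym_le => // u su; apply: (le_trans (close _ u (Ghat w) su)).
  rewrite -/b.
  have -> : C1 * y = M * (y * (2 * b + T) / b ^+ 2) by rewrite /C1; ring.
  have yT : y * (2 * b + y) / b ^+ 2 <= y * (2 * b + T) / b ^+ 2.
    rewrite ler_wpM2r ?invr_ge0 ?exprn_ge0 ?(ltW b0)// ler_wpM2l//.
    by rewrite lerD2l.
  apply: ler_pM => //.
  - by case: pdS => _ S0; have [->|u0] := eqVneq u 0; [rewrite /qform mulmx0 mxE|exact/ltW/S0].
  - have b2y : 0 <= 2 * b + y by rewrite addr_ge0// mulr_ge0// ltW.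
    by rewrite mulr_ge0 ?invr_ge0 ?exprn_ge0 ?(ltW b0)// mulr_ge0.
  - exact: qform_le_eigenvalue_bound su.
have op_ge := opnorm_ge0 A.
apply: (@le_trans _ _ ((C1 * y) ^+ 2)).
  by rewrite lerXn2r ?nnegrE// (le_trans op_ge op_le).
rewrite exprMn -mulrA ler_wpM2l ?sqr_ge0//.
set B := B_E eps ^+ 2; set mx := Num.max _ _.
have mx1 : p%:R / n%:R <= mx by rewrite le_max lexx.
have mx2 : B <= mx by rewrite le_max lexx orbT.
have Ln : 0 <= L / n%:R by rewrite divr_ge0// ltW.
have y2 : y ^+ 2 <= 2 * b ^+ 2 * B + 8 * k ^+ 2 / g ^+ 2 * rho.
  have -> : 8 * k ^+ 2 / g ^+ 2 * rho = 2 * (2 * r / g) ^+ 2.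
    rewrite /r !exprMn sqr_sqrtr ?(ltW rho0)// exprVn; field.
    by rewrite gt_eqF.
  have -> : 2 * b ^+ 2 * B = 2 * (b * B_E eps) ^+ 2 by rewrite /B; ring.
  have := sqr_ge0 (b * B_E eps - 2 * r / g); rewrite /y.
  move: (b * B_E eps) (2 * r / g) => a c; clear; lra.
apply: (le_trans y2); rewrite [leRHS]mulrDl; apply: lerD.
  by rewrite ler_wpM2l ?(ltW C2)// ler_wpDr.
by rewrite ler_wpM2l ?(ltW C3)// /rho mulrDl lerD2r.
Qed.
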